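(* Let $H$ be a complex Hilbert space, let $T\in B(H)$ be power bounded with $\sigma_p(T)\cap\mathbb{T}=\emptyset$, and let $f\in P_m$ for some $m\in\mathbb{N}$. Then for every function $g$ of the form $g(t)=\sum_{j=0}^k c_jt^{\alpha_j}$ with $k\in\mathbb{N}\cup\{0\}$ and $c_0,\dots,c_k,\alpha_0,\dots,\alpha_k\in\mathbb{R}$, and for every $x\in H$, $$ \lim_{N\to\infty}\frac1N\sum_{n=1}^N e^{2\pi i g(n)}T^{[f(n)]}x=0 $$ in the norm of $H$; that is, these averages converge to $0$ in the strong operator topology.
   Context: $\mathbb{T}$ is the unit circle in $\mathbb{C}$, $\sigma_p(T)$ is the set of eigenvalues of $T$, $T$ is power bounded if $\sup_{n\ge0}\|T^n\|<\infty$, and $[\cdot]$ is the integer part. Convention: $T^{[f(n)]}=I$ if the exponent is negative or $f(n)$ is not defined (this concerns only finitely many $n$). Class $P_m$ ($m\in\mathbb{N}$, $m\ge1$): a continuous real function $f$ defined on some interval $[t_0,\infty)$ (functions agreeing for all large $t$ are identified) is of class $P_m$ if, for all $t$ large enough, $f$ has continuous derivatives $f',\dots,f^{(m)}$ with $f,f',\dots,f^{(m)}>0$, and $$\limsup_{t\to\infty}\frac{f^{(m-1)}(t)}{t f^{(m)}(t)}<\infty,\qquad \limsup_{t\to\infty}\sup\Bigl\{\frac{f^{(m)}(s)}{f^{(m)}(t)}: s\ge t\Bigr\}<\infty.$$ *)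

(* Defs.v *)
From HB Require Import structures.
From mathcomp Require Import all_boot all_order all_algebra.
From mathcomp Require Import sesquilinear.
From mathcomp Require Import all_classical all_reals all_analysis.
From mathcomp Require Import complex.

Set Implicit Arguments.
Unset Strict Implicit.
Unset Printing Implicit Defensive.

Import Order.TTheory GRing.Theory Num.Theory.
Import numFieldNormedType.Exports.

Local Open Scope classical_set_scope.
Local Open Scope complex_scope.
Local Open Scope ring_scope.

(* The norm of a [normedModType R[i]] takes its values in R[i]; these values
   are real, and [complex.Re] reads them as elements of R. *)
Definition opnorm (R : realType) (H : normedModType R[i]) (S : H -> H)
  : \bar R :=
  ereal_sup [set (complex.Re `|S x|)%:E | x in [set x : H | `|x| <= 1]].

Definition power_bounded (R : realType) (H : normedModType R[i])
    (T : H -> H) : Prop :=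
  (ereal_sup (range (fun n : nat => opnorm (iter n T))) < +oo)%E.

Definition point_spectrum (R : realType) (H : normedModType R[i])
    (T : H -> H) : set R[i] :=
  [set l | exists2 x : H, x != 0 & T x = l *: x].

Arguments point_spectrum {R H} T.

Definition unit_circle (R : realType) : set R[i] := [set z | `|z| = 1].
Arguments unit_circle R : clear implicits.

(* A real function on [t0, +oo[ is a total function f : R -> R together with
   t0; the values of f below t0 are never used. *)
Definition class_P (R : realType) (m : nat) (t0 : R) (f : R -> R) : Prop :=
  [/\ {within `[t0, +oo[, continuous f},
      \forall t \near +oo,
        [/\ forall k, (k < m)%N -> derivable (derive1n k f) t 1,
            forall k, (k <= m)%N -> {for t, continuous (derive1n k f)}
          & forall k, (k <= m)%N -> 0 < derive1n k f t],
      (limf_esup (fun t : R => (derive1n m.-1 f t / (t * derive1n m f t))%:E)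
                 (pinfty_nbhs R) < +oo)%E
    & (limf_esup (fun t : R => ereal_sup
                    [set (derive1n m f s / derive1n m f t)%:E | s in `[t, +oo[])
                 (pinfty_nbhs R) < +oo)%E].

(* T^[f(n)] x, with the convention that T^[f(n)] is the identity when f(n) is
   undefined (n < t0) or its integer part is negative. *)
Definition iter_int_part (R : realType) (H : Type) (T : H -> H)
    (t0 : R) (f : R -> R) (n : nat) (x : H) : H :=
  if (t0 <= n%:R) && (0 <= Num.floor (f n%:R))
  then iter `|Num.floor (f n%:R)|%N T x else x.

(* e^(2 pi i t) *)
Definition e2pii (R : realType) (t : R) : R[i] :=
  cos (2 * pi * t) +i* sin (2 * pi * t).

Definition real_power_sum (R : realType) (k : nat) (c alpha : 'I_k.+1 -> R)
    (t : R) : R :=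
  \sum_(j < k.+1) c j * t `^ alpha j.

(* Main.v *)
(* The averages converge for arbitrary bounded weights in place of
   e^(2 pi i g(n)), uniformly in the weights; this stronger form also absorbs
   the jumps of the integer part.

   - Integer exponents [a n = n].  The ergodic averages of [l T] tend to 0,
     uniformly for [l] on the unit circle, because [T] has no unimodular
     eigenvalue.  The sums of [c n T^(n+j) x] form a convolution in [j], so
     Parseval on the roots of unity bounds their mean square over [j] by these
     ergodic averages, and power boundedness passes from the mean over [j] to
     the single sum with [j] large.
   - If [f] is of class P_1, then [floor (f n)] takes the value [v <= f N] at
     most O(N / f N) times for [n <= N], which reduces to the case [a n = n].
   - If [f] is of class P_(m+2), then [f (n + d) - f n] is of class P_(m+1).
     The van der Corput inequality is applied on windows (N - K, N] with
     [K = N / q], in the semi-inner product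
     [sum_(j < L) <T^j u, T^j v>] with [L = floor (f (N - K))].  Moving by
     [floor (f n) - L] steps, which is small compared with [L] because
     [n (f (n + 1) - f n) = O(f n)], changes it little; hence [T] behaves like
     an isometry and the correlations become averages along the differences.

   The class P_m enters only through the finite differences of [n |-> f n],
   for which it is visibly stable under [f |-> f (n + d) - f n]. *)

Require Import Defs.
From HB Require Import structures.
From mathcomp Require Import all_boot all_order all_algebra.
From mathcomp Require Import sesquilinear.
From mathcomp Require Import all_classical all_reals all_analysis.
From mathcomp Require Import complex.
From mathcomp Require Import ring lra zify.

Set Implicit Arguments.
Unset Strict Implicit.
Unset Printing Implicit Defensive.

Import Order.TTheory GRing.Theory Num.Theory.
Import numFieldNormedType.Exports.

Local Open Scope classical_set_scope.
Local Open Scope complex_scope.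
Local Open Scope ring_scope.

(** * Real-valued norm and inner product *)

Section Norm.
Variables (R : realType) (H : normedModType R[i]).
Implicit Types (u v : H) (a : R[i]) (r : R).

Definition nrm u : R := complex.Re `|u|.
Definition cabs (a : R[i]) : R := complex.Re `|a|.

Lemma ReD (a b : R[i]) : complex.Re (a + b) = complex.Re a + complex.Re b.
Proof. by case: a; case: b. Qed.

Lemma ReM_real r (b : R[i]) : complex.Re (r%:C * b) = r * complex.Re b.
Proof. by case: b => x y /=; rewrite mul0r subr0. Qed.

Lemma nrmE u : `|u| = (nrm u)%:C.
Proof. by rewrite RRe_real// normr_real. Qed.

Lemma cabsE a : `|a| = (cabs a)%:C.
Proof. by rewrite RRe_real// normr_real. Qed.

Lemma leC_real (r s : R) : (r%:C <= s%:C) = (r <= s).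
Proof. by rewrite lecE /= eqxx. Qed.

Lemma ltC_real (r s : R) : (r%:C < s%:C) = (r < s).
Proof. by rewrite ltcE /= eqxx. Qed.

Lemma nrm_ge0 u : 0 <= nrm u.
Proof. by rewrite -leC_real -nrmE normr_ge0. Qed.

Lemma nrm0 : nrm 0 = 0.
Proof. by rewrite /nrm normr0. Qed.

Lemma nrm_eq0 u : nrm u = 0 -> u = 0.
Proof. by move=> u0; apply/eqP; rewrite -normr_eq0 nrmE u0. Qed.

Lemma nrmD u v : nrm (u + v) <= nrm u + nrm v.
Proof. by rewrite -leC_real -nrmE rmorphD /= -!nrmE ler_normD. Qed.

Lemma nrmN u : nrm (- u) = nrm u.
Proof. by rewrite /nrm normrN. Qed.

Lemma nrmB u v : nrm (u - v) = nrm (v - u).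
Proof. by rewrite /nrm distrC. Qed.

Lemma nrmBD u v : nrm (u - v) <= nrm u + nrm v.
Proof. by rewrite -(nrmN v) nrmD. Qed.

Lemma nrmZ a u : nrm (a *: u) = cabs a * nrm u.
Proof.
by apply: (@complexI R); rewrite -nrmE normrZ cabsE nrmE rmorphM.
Qed.

Lemma cabs_ge0 a : 0 <= cabs a.
Proof. by rewrite -leC_real -cabsE normr_ge0. Qed.

Lemma cabs_real r : cabs r%:C = `|r|.
Proof. by rewrite /cabs normc_def /= expr0n addr0 sqrtr_sqr. Qed.

Lemma cabsM a (b : R[i]) : cabs (a * b) = cabs a * cabs b.
Proof. by apply: (@complexI R); rewrite rmorphM /= -!cabsE normrM. Qed.

Lemma cabsD a (b : R[i]) : cabs (a + b) <= cabs a + cabs b.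
Proof. by rewrite -leC_real rmorphD /= -!cabsE ler_normD. Qed.

Lemma cabsX a n : cabs (a ^+ n) = cabs a ^+ n.
Proof. by apply: (@complexI R); rewrite rmorphXn /= -!cabsE normrX. Qed.

Lemma nrmZ_real r u : nrm (r%:C *: u) = `|r| * nrm u.
Proof. by rewrite nrmZ cabs_real. Qed.

Lemma nrm_sum (I : Type) (s : seq I) (P : pred I) (F : I -> H) :
  nrm (\sum_(i <- s | P i) F i) <= \sum_(i <- s | P i) nrm (F i).
Proof.
elim/big_rec2: _ => [|i y z _ le]; first by rewrite nrm0.
by rewrite (le_trans (nrmD _ _))// lerD2l.
Qed.

Lemma nrm_sum_const (F : nat -> H) m n (b : R) :
  (forall i, (m <= i < n)%N -> nrm (F i) <= b) ->
  nrm (\sum_(m <= i < n) F i) <= (n - m)%:R * b.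
Proof.
move=> Fb; rewrite (le_trans (nrm_sum _ _ _))//.
rewrite big_seq (le_trans (ler_sum _ (G := fun=> b) _))//.
  by move=> i; rewrite mem_index_iota => /Fb.
by rewrite -big_seq sumr_const_nat mulr_natl.
Qed.

Lemma cvg_nrm (u_ : nat -> H) v :
  (forall e, 0 < e -> exists n0, forall n, (n0 <= n)%N -> nrm (u_ n - v) <= e) ->
  u_ @ \oo --> v.
Proof.
move=> uv; apply/cvgrPdist_le => -[e ei]; rewrite ltcE /= => /andP[/eqP-> e0].
have [n0 n0P] := uv _ e0; exists n0 => // n /= n0n.
by rewrite nrmE leC_real nrmB n0P.
Qed.

End Norm.

Section Inner.
Variables (R : realType) (H : normedModType R[i]) (dot : {dot H for Num.conj}).
Hypothesis dot_norm : forall x : H, dot x x = `|x| ^+ 2.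
Implicit Types (u v w : H) (a : R[i]) (r : R).

Lemma dotDl u v w : dot (u + v) w = dot u w + dot v w.
Proof. exact: linearDl. Qed.

Lemma dotC u v : dot u v = Num.conj (dot v u).
Proof. by rewrite hermC /= expr0 mul1r. Qed.

Lemma dotZl a u v : dot (a *: u) v = a * dot u v.
Proof. exact: linearZl. Qed.

Lemma dotZr a u v : dot u (a *: v) = Num.conj a * dot u v.
Proof. by rewrite dotC dotZl rmorphM; congr (_ * _); exact/esym/dotC. Qed.

Definition ip u v : R := complex.Re (dot u v).

Lemma ipC u v : ip u v = ip v u.
Proof. by rewrite /ip dotC; case: (dot v u). Qed.

Lemma ipDl u v w : ip (u + v) w = ip u w + ip v w.
Proof. by rewrite /ip dotDl ReD. Qed.

Lemma ipDr u v w : ip w (u + v) = ip w u + ip w v.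
Proof. by rewrite ipC ipDl !(ipC w). Qed.

Lemma ipZl r u v : ip (r%:C *: u) v = r * ip u v.
Proof. by rewrite /ip dotZl ReM_real. Qed.

Lemma ip_nrm u : ip u u = nrm u ^+ 2.
Proof. by rewrite /ip dot_norm nrmE -rmorphXn. Qed.

Lemma nrmD2 u v : nrm (u + v) ^+ 2 = nrm u ^+ 2 + nrm v ^+ 2 + 2 * ip u v.
Proof. by rewrite -!ip_nrm ipDl !ipDr (ipC v u); ring. Qed.

Lemma ip_le u v : ip u v <= nrm u * nrm v.
Proof.
have := nrmD u v; rewrite -(@ler_pXn2r _ 2) ?nnegrE ?addr_ge0 ?nrm_ge0//.
by rewrite nrmD2; lra.
Qed.

Lemma ipN u v : ip (- u) v = - ip u v.
Proof.
by apply/eqP; rewrite -addr_eq0 -ipDl addNr /ip -(scale0r u) dotZl mul0r.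
Qed.

Lemma ip_abs u v : `|ip u v| <= nrm u * nrm v.
Proof. by rewrite ler_norml ip_le andbT lerNl -ipN -(nrmN u) ip_le. Qed.

Lemma ip0l v : ip 0 v = 0.
Proof. by rewrite -(scale0r (0 : H)) /ip dotZl mul0r. Qed.

Lemma ip_suml (I : Type) (s : seq I) (P : pred I) (F : I -> H) v :
  ip (\sum_(i <- s | P i) F i) v = \sum_(i <- s | P i) ip (F i) v.
Proof. by elim/big_rec2: _ => [|i y z _ <-]; rewrite ?ip0l ?ipDl. Qed.

Lemma ip_sumr (I : Type) (s : seq I) (P : pred I) (F : I -> H) v :
  ip v (\sum_(i <- s | P i) F i) = \sum_(i <- s | P i) ip v (F i).
Proof. by rewrite ipC ip_suml; apply: eq_bigr => i _; rewrite ipC. Qed.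

Lemma parallelogram u v :
  nrm (u + v) ^+ 2 + nrm (u - v) ^+ 2 = 2 * nrm u ^+ 2 + 2 * nrm v ^+ 2.
Proof. by rewrite !nrmD2 nrmN (ipC u (- v)) ipN (ipC v u); ring. Qed.

End Inner.

(** * Finite differences *)

Section Differences.
Variable R : realType.
Implicit Types (f g : nat -> R) (C : R).

Definition fdiff f (n : nat) : R := f n.+1 - f n.

(** The discrete counterpart of class P_m: differences replace derivatives, and a single constant
    [C] bounds both quotients from some index on, with the denominators multiplied out. *)
Definition discrete_P (m : nat) f : Prop :=
  exists C n0, forall n, (n0 <= n)%N ->
    [/\ forall k, (k <= m)%N -> 0 < iter k fdiff f n,
        iter m.-1 fdiff f n <= C * n%:R * iter m fdiff f n
      & forall s, (n <= s)%N -> iter m fdiff f s <= C * iter m fdiff f n].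

(** The discrete form of t f'(t) = O(f(t)): the relative variation of [f] is small on windows that
    are short compared with their position. *)
Definition slow f : Prop :=
  exists C n0, forall n, (n0 <= n)%N ->
    [/\ 0 < f n, 0 <= fdiff f n & n%:R * fdiff f n <= C * f n].

Lemma sum_fdiff f m n : (m <= n)%N ->
  f n = f m + \sum_(m <= i < n) fdiff f i.
Proof. by move=> mn; rewrite telescope_sumr// addrC subrK. Qed.

Lemma fdiff_nondecr f n0 : (forall n, (n0 <= n)%N -> 0 <= fdiff f n) ->
  forall m n, (n0 <= m)%N -> (m <= n)%N -> f m <= f n.
Proof.
move=> f0 m n n0m mn; rewrite (sum_fdiff f mn) lerDl big_nat_cond sumr_ge0// => i.
by rewrite andbT => /andP[mi _]; apply: f0; exact: leq_trans mi.
Qed.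

Lemma sum_nat_ge (g : nat -> R) m n b :
  (forall i, (m <= i < n)%N -> b <= g i) ->
  (n - m)%:R * b <= \sum_(m <= i < n) g i.
Proof.
move=> gb; rewrite mulr_natl -sumr_const_nat.
by rewrite big_seq [leRHS]big_seq ler_sum// => i; rewrite mem_index_iota => /gb.
Qed.

Lemma iter_fdiff_sum g r k n :
  iter k fdiff (fun n => \sum_(i < r) g (n + i)%N) n =
  \sum_(i < r) iter k fdiff g (n + i)%N.
Proof.
elim: k n => // k IH n; rewrite iterS {1}/fdiff !IH -sumrB.
by apply: eq_bigr => i _; rewrite iterS addSn.
Qed.

Lemma iter_fdiff_increment f r k n :
  iter k fdiff (fun n => f (n + r)%N - f n) n =
  \sum_(i < r) iter k.+1 fdiff f (n + i)%N.
Proof.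
rewrite iterSr -iter_fdiff_sum; congr (iter k fdiff _ n).
apply/funext => j; rewrite (sum_fdiff f (leq_addr r j)) addrC addKr.
by rewrite -{1}[j]add0n big_addn addKn big_mkord; apply: eq_bigr => i _; rewrite addnC.
Qed.

(** The increment is a sum of r shifts of [fdiff f], so its difference of order k is a sum of r
    shifts of the difference of order k + 1 of [f]; the three conditions are added over these
    shifts. *)
Lemma discrete_P_increment m f r : (0 < r)%N -> discrete_P m.+2 f ->
  discrete_P m.+1 (fun n => f (n + r)%N - f n).
Proof.
(* For n >= 1 and i < r one has n + i <= (r + 1) n, which explains the factor [r.+1%:R] and the
   lower bound 1 on the threshold. *)
move=> r0 [C [n0 H]]; exists (`|C| * r.+1%:R), (maxn n0 1) => n.
rewrite geq_max => /andP[n0n n1].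
have Hi i := H (n + i)%N (leq_trans n0n (leq_addr i n)).
have C0 : 0 < C.
  have [p _ /(_ n (leqnn n))] := H n n0n.
  by have := p _ (leqnn _); set x := iter _ _ _ _ => x0; nra.
rewrite gtr0_norm//; split => [k km||s ns]; rewrite !iter_fdiff_increment.
- case: r r0 => // r _; rewrite big_ord_recl ltr_wpDr//.
    by rewrite sumr_ge0// => i _; have [p _ _] := Hi (lift ord0 i); rewrite ltW// p.
  by have [p _ _] := Hi 0%N; exact: p.
- rewrite /= mulr_sumr ler_sum// => i _.
  have [p + _] := Hi i; have := p m.+2 (leqnn _).
  move=> /= q0 /le_trans; apply; apply: ler_wpM2r; first exact: ltW.
  rewrite -mulrA ler_wpM2l ?(ltW C0)// -natrM ler_nat mulSn leq_add2l.
  by rewrite (leq_trans (ltnW (ltn_ord i)))// leq_pmulr.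
- rewrite mulr_sumr ler_sum// => i _.
  have [p _ /(_ (s + i)%N)] := Hi i; rewrite leq_add2r => /(_ ns) /le_trans; apply.
  have := p m.+2 (leqnn _) => /= q0; apply: ler_wpM2r; first exact: ltW.
  by rewrite ler_peMr ?ler1n// ltW.
Qed.

(** [f n] exceeds the sum of its increments from n0 on, each of which is at least [fdiff f n / C];
    for n >= 2 n0 there are at least n / 2 of them. *)
Lemma slow_quasi_decr f C n0 :
  (forall n, (n0 <= n)%N -> 0 < f n /\ 0 < fdiff f n) ->
  (forall n s, (n0 <= n)%N -> (n <= s)%N -> fdiff f s <= C * fdiff f n) ->
  slow f.
Proof.
move=> f0 df; exists (2 * C), (2 * n0)%N => n n0n.
have n0n' : (n0 <= n)%N by lia.
have [fn dfn] := f0 _ n0n'; split => //; first exact: ltW.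
have C0 : 0 < C by have := df _ _ n0n' (leqnn _); nra.
rewrite (sum_fdiff f n0n').
have H : (n - n0)%:R * (fdiff f n / C) <= \sum_(n0 <= i < n) fdiff f i.
  by apply: sum_nat_ge => i /andP[n0i /ltnW ni]; rewrite ler_pdivrMr// mulrC df.
have f00 := (f0 _ (leqnn n0)).1.
have n2 : n%:R <= 2 * (n - n0)%:R :> R by rewrite -natrM ler_nat; lia.
have : n%:R * fdiff f n <= 2 * C * ((n - n0)%:R * (fdiff f n / C)).
  rewrite [leRHS](_ : _ = 2 * (n - n0)%:R * fdiff f n) ?ler_pM2r//.
  by field; rewrite gt_eqF.
move/le_trans; apply; rewrite ler_pM2l ?mulr_gt0//; lra.
Qed.

(** The discrete version of integrating (t f')' = f' + t f'' <= (C + 1) f'. *)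
Lemma slow_fdiff f n0 : (forall n, (n0 <= n)%N -> 0 < f n) ->
  slow (fdiff f) -> slow f.
Proof.
move=> f0 [C [n1 H]].
pose n2 := maxn (maxn n0 n1) 2; pose A := n2%:R * fdiff f n2.
have n2n0 n : (n2 <= n)%N -> [/\ (n0 <= n)%N, (n1 <= n)%N & (2 <= n)%N].
  by rewrite /n2 !geq_max => /andP[/andP[-> ->] ->].
have C0 : 0 <= C.
  have [_ n12 _] := n2n0 _ (leqnn _).
  have [d0 dd0 dC] := H _ n12; rewrite -(pmulr_lge0 _ d0).
  by apply: le_trans dC; rewrite mulr_ge0.
have sum n : (n2 <= n)%N -> n%:R * fdiff f n <= A + C * f n + f n.+1.
  elim: n => [|n IH]; first by move=> /n2n0[].
  rewrite leq_eqVlt => /orP[/eqP e|].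
    have [a _ _] := n2n0 n.+1 (eq_leq e).
    rewrite /A e -addrA lerDl addr_ge0 ?mulr_ge0// ltW// f0//.
    by rewrite ltnW// ltnS.
  rewrite ltnS => n2n; have {IH} := IH n2n.
  have [_ /H[_ _ +] _] := n2n0 _ n2n.
  by rewrite /fdiff -natr1; lra.
(* The constant [A] is absorbed through [f n2 <= f n]. The term [fdiff f n] hidden in [f n.+1] moves
   to the left side, which costs the factor 2 because n >= 2. *)
exists (2 * (A / f n2 + C + 1)), n2 => n n2n.
have [a b c] := n2n0 _ n2n; have [d0 _ _] := H _ b.
split; [exact: f0|exact: ltW|].
have f2 : 0 < f n2 by apply: f0; have [] := n2n0 _ (leqnn _).
have mon : f n2 <= f n.
  apply: (@fdiff_nondecr f n2) => // k /n2n0[_ k1 _].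
  by rewrite ltW//; have [] := H _ k1.
have A0 : 0 <= A.
  rewrite /A mulr_ge0// ltW//; have [_ k1 _] := n2n0 _ (leqnn _).
  by have [] := H _ k1.
have Af : A <= A / f n2 * f n by rewrite -mulrA ler_peMr// mulrC ler_pdivlMr// mul1r.
have n2R : 2 <= n%:R :> R by rewrite ler_nat.
have := sum _ n2n; have -> : f n.+1 = f n + fdiff f n by rewrite addrC subrK.
by set x := A / _ in Af *; nra.
Qed.

(** The difference of order m + 1 is quasi-decreasing, so the one of order m is slow; slowness then
    descends one order at a time down to [f]. *)
Lemma discrete_P_slow m f : discrete_P m.+1 f -> slow f.
Proof.
move=> [C [n0 H]].
suff S k : (k <= m)%N -> slow (iter (m - k) fdiff f).
  by have := S m (leqnn _); rewrite subnn.
elim: k => [_|k IH km].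
  rewrite subn0; apply: (@slow_quasi_decr _ C n0) => [n n0n|n s n0n ns].
    by have [p _ _] := H _ n0n; split; [exact: p|exact: (p m.+1)].
  by have [_ _] := H _ n0n; exact.
apply: (@slow_fdiff _ n0) => [n n0n|].
  by have [p _ _] := H _ n0n; apply: p; lia.
by rewrite -iterS -subSn ?subSS; [apply: IH; lia|].
Qed.

(** In order one, [f i <= C i (fdiff f i)] forces each of the n increments on [n, 2n) to be at least
    [f n1] / (2 C n), so every doubling of n adds the fixed amount [e]. In higher order the
    increments are positive and nondecreasing, so growth is at least linear. *)
Lemma discrete_P_unbounded m f : discrete_P m.+1 f ->
  forall b, exists n0, forall n, (n0 <= n)%N -> b <= f n.
Proof.
move=> [C [n0 H]] b.
have pos n : (n0 <= n)%N -> 0 < f n.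
  by move=> /H[p _ _]; exact: (p 0%N).
have d0 n : (n0 <= n)%N -> 0 < fdiff f n.
  by move=> /H[p _ _]; exact: (p 1%N).
have mon := @fdiff_nondecr f n0 (fun n h => ltW (d0 n h)).
suff [n1 n01 fb] : exists2 n1, (n0 <= n1)%N & b <= f n1.
  by exists n1 => n n1n; rewrite (le_trans fb)// mon.
case: m H => [|m] H.
  pose n1 := maxn n0 1; pose e := f n1 / (2 * C).
  have C0 : 0 < C.
    have [] := H n0 (leqnn _); have [_ _ /(_ n0 (leqnn _))] := H n0 (leqnn _).
    by have := d0 _ (leqnn n0); rewrite /= /fdiff; nra.
  have n01 : (n0 <= n1)%N by rewrite leq_maxl.
  have e0 : 0 < e by rewrite divr_gt0 ?pos ?mulr_gt0.
  have step n : (n1 <= n)%N -> f n + e <= f (n * 2)%N.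
    move=> n1n; have nn : (n <= n * 2)%N by rewrite leq_pmulr.
    rewrite (sum_fdiff f nn) lerD2l.
    have n_gt0 : (0 < n)%N by rewrite (leq_trans _ n1n)// leq_maxr.
    have -> : e = (n * 2 - n)%:R * (f n1 / (C * (n * 2)%:R)).
      rewrite /e (_ : (n * 2 - n)%N = n); last by lia.
      rewrite natrM; field; rewrite pnatr_eq0 -lt0n n_gt0 /=.
      by rewrite gt_eqF.
    apply: sum_nat_ge => i /andP[ni i2].
    have n0i : (n0 <= i)%N by rewrite (leq_trans n01)// (leq_trans n1n).
    rewrite ler_pdivrMr; last by rewrite mulr_gt0// ltr0n; lia.
    have [_ h _] := H _ n0i; have fi := mon _ _ n01 (leq_trans n1n ni).
    rewrite (le_trans fi)// (le_trans h)//= mulrC ler_wpM2l ?(ltW (d0 _ _))//.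
    by rewrite ler_wpM2l ?(ltW C0)// ler_nat ltnW.
  have iter_step k : k%:R * e <= f (n1 * 2 ^ k)%N.
    elim: k => [|k IH]; first by rewrite mul0r expn0 muln1 ltW// pos.
    rewrite expnSr mulnA -natr1 mulrDl mul1r.
    apply: le_trans (step _ _); first by rewrite lerD2r.
    by rewrite leq_pmulr ?expn_gt0.
  pose k := (Num.truncn (`|b| / e)).+1.
  exists (n1 * 2 ^ k)%N; first by rewrite (leq_trans n01)// leq_pmulr ?expn_gt0.
  rewrite (le_trans _ (iter_step k))// (le_trans (ler_norm _))//.
  by rewrite -ler_pdivrMr// ltW// truncnS_gt.
have d2 n : (n0 <= n)%N -> 0 <= fdiff (fdiff f) n.
  by move=> /H[p _ _]; exact/ltW/(p 2%N).
have dmon := @fdiff_nondecr _ n0 d2.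
pose k := (Num.truncn (`|b| / fdiff f n0)).+1.
exists (n0 + k)%N; rewrite ?leq_addr// (sum_fdiff f (leq_addr k n0)).
have : k%:R * fdiff f n0 <= \sum_(n0 <= i < n0 + k) fdiff f i.
  rewrite -{1}(addKn n0 k); apply: sum_nat_ge => i /andP[n0i _].
  exact: dmon.
have : `|b| <= k%:R * fdiff f n0.
  by rewrite -ler_pdivrMr ?d0// ltW// truncnS_gt.
have := pos _ (leqnn n0); have := ler_norm b; lra.
Qed.

End Differences.

(** * From derivatives to finite differences *)

Section Derivatives.
Variable R : realType.
Implicit Types (f : R -> R) (t C : R).

Lemma limf_esup_bounded (g : R -> \bar R) :
  (limf_esup g (pinfty_nbhs R) < +oo)%E ->
  exists C A : R, forall t, A < t -> (g t <= C%:E)%E.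
Proof.
move=> /ereal_inf_lt[_ [V [A [_ AV]] <-] VC].
have [C VC'] : exists C : R, (ereal_sup [set g x | x in V] <= C%:E)%E.
  move: VC; case: ereal_sup => [r _|//|_]; first by exists r.
  by exists 0; rewrite leNye.
exists C, A => t At; apply: le_trans VC'; apply: ereal_sup_ubound.
by exists t => //; exact: AV.
Qed.

Lemma mvt_is_derive (g dg : R -> R) (A a b : R) :
  (forall t, A < t -> is_derive t 1 g (dg t)) -> A < a -> a < b ->
  exists2 x, a < x < b & g b - g a = dg x * (b - a).
Proof.
move=> dgP Aa ab.
have [||x] := @MVT R g dg a b ab; last by rewrite in_itv; exists x.
  by move=> x; rewrite in_itv /= => /andP[ax _]; exact/dgP/(lt_trans Aa).
apply: derivable_within_continuous => x; rewrite in_itv /= => /andP[ax _].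
by have /@ex_derive := dgP _ (lt_le_trans Aa ax).
Qed.

(** An iterated mean value theorem. The family [G] lists the successive derivatives; the induction
    replaces it by the unit increments G_j(t + 1) - G_j(t), and one application of the mean value
    theorem removes the last increment. *)
Lemma iter_fdiff_derive k (G : nat -> R -> R) (A : R) :
  (forall j t, (j < k)%N -> A < t -> is_derive t 1 (G j) (G j.+1 t)) ->
  forall n : nat, A < n%:R ->
  exists2 x, n%:R <= x <= n%:R + k%:R &
    iter k (@fdiff R) (fun i => G 0%N i%:R) n = G k x.
Proof.
elim: k G => [|k IH] G dG n An; first by exists n%:R; rewrite ?addr0 ?lexx.
pose G' j t := G j (t + 1) - G j t.
have dG' j t : (j < k)%N -> A < t -> is_derive t 1 (G' j) (G' j.+1 t).
  move=> jk At; have jk' : (j < k.+1)%N by rewrite ltnW.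
  have At1 : A < t + 1 by rewrite (lt_trans At)// ltrDl.
  have := dG j _ jk' At; have := dG j _ jk' At1 => d1 d2.
  have d3 : is_derive t 1 (fun t : R => t + 1) 1.
    by rewrite -[X in is_derive _ _ _ X]addr0; apply: is_deriveD.
  have := is_derive1_comp (g := fun t : R => t + 1) d1 d3; rewrite mulr1 => d4.
  exact: is_deriveB.
have [x /andP[nx xk] xE] := IH G' dG' n An.
rewrite iterSr (_ : fdiff _ = fun i => G' 0%N i%:R); last first.
  by apply/funext => i; rewrite /fdiff /G' -natr1.
rewrite xE /G'; have Ax := lt_le_trans An nx.
have [y /andP[xy yx] ->] := @mvt_is_derive (G k) (G k.+1) A x (x + 1)
  (fun t => dG k t (leqnn _)) Ax (ltr_pwDr ltr01 (lexx _)).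
exists y; last by rewrite addrAC subrr add0r mulr1.
by rewrite (le_trans nx (ltW xy))/= (le_trans (ltW yx))// -natr1 addrA lerD2r.
Qed.

(** Each difference of order k at n is a derivative of order k at some point of [n, n + k]. These
    points depend on the order, so the derivatives must be compared across bounded distances, in
    both directions: [b2] forward, [b3] backward. *)
Lemma class_P_discrete m t0 f : class_P m.+1 t0 f ->
  discrete_P m.+1 (fun n => f n%:R).
Proof.
move=> [_ [A1 [_ H]] /limf_esup_bounded[C1 [A2 H1]] /limf_esup_bounded[C2 [A3 H2]]].
pose F k := derive1n k f.
pose C := Num.max C1 (Num.max C2 1).
pose A := Num.max A1 (Num.max A2 (Num.max A3 1)).
have AE t : A < t -> [/\ A1 < t, A2 < t, A3 < t & 1 < t].
  by rewrite !gt_max => /andP[-> /andP[-> /andP[-> ->]]].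
have C_ge1 : 1 <= C by rewrite !le_max lexx !orbT.
have C0 : 0 < C by exact: lt_le_trans C_ge1.
have A0 : 1 <= A by rewrite !le_max lexx !orbT.
have dF k t : (k < m.+1)%N -> A < t -> is_derive t 1 (F k) (F k.+1 t).
  move=> km /AE[/H[d _ _] _ _ _].
  by rewrite /F derive1nS derive1E; apply: derivableP; exact: d.
have pF k t : (k <= m.+1)%N -> A < t -> 0 < F k t.
  by move=> km /AE[/H[_ _ p] _ _ _]; exact: p.
have b1 t : A < t -> F m t <= C * t * F m.+1 t.
  move=> At; have [_ /H1 + _ t1] := AE _ At; have := pF m.+1 t (leqnn _) At.
  rewrite lee_fin /= -/(F m) -/(F m.+1) => p.
  have tp : 0 < t * F m.+1 t by rewrite mulr_gt0 ?(lt_trans _ t1).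
  rewrite ler_pdivrMr// -mulrA => /le_trans; apply; rewrite ler_pM2r//.
  by rewrite le_max lexx.
have b2 s t : A < t -> t <= s -> F m.+1 s <= C * F m.+1 t.
  move=> At ts; have [_ _ /H2 h _] := AE _ At.
  have : ((F m.+1 s / F m.+1 t)%:E <= C2%:E)%E.
    apply: le_trans h; apply: ereal_sup_ubound; exists s => //=.
    by rewrite in_itv /= ts.
  rewrite lee_fin ler_pdivrMr ?pF// => /le_trans; apply.
  by rewrite ler_pM2r ?pF// !le_max lexx !orbT.
(* The top derivative does not drop by more than a constant factor over a
   bounded interval, since t F_(m+1)(t) and F_m(t) are comparable. *)
pose D := 2 * C ^+ 2 * m.+2%:R.
have D_ge : C <= D.
  have ? : 1 <= m.+2%:R :> R by rewrite ler1n.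
  have ? : C <= C ^+ 2 by nra.
  by rewrite /D; nra.
have b3 s t : 2 * A < t -> s <= t + m.+1%:R -> F m.+1 t <= D * F m.+1 s \/ s <= A.
  move=> At st; have [sA|As] := leP s A; [by right|left].
  have At' : A < t by apply: le_lt_trans At; lra.
  have [lts|gts] := leP s t.
    by rewrite (le_trans (b2 _ _ As lts))// ler_pM2r ?pF.
  (* For s > t, the mean value theorem on [t / 2, t] together with [b2] bounds t F_(m+1)(t) by 2 C
     F_m(t). Since F_m increases, [b1] at s then brings in F_(m+1)(s), and s <= (m + 2) t produces
     the factor [m.+2%:R] of [D]. *)
  have At2 : A < t / 2 by lra.
  have Ast := pF m.+1 _ (leqnn _) As; have Pt := pF m.+1 _ (leqnn _) At'.
  have [x /andP[x1 x2] xE] := @mvt_is_derive (F m) (F m.+1) A (t / 2) t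
    (fun t => dF m t (leqnn _)) At2 ltac:(lra).
  have h1 : t * F m.+1 t <= 2 * C * F m t.
    have := b2 t x (lt_trans At2 x1) (ltW x2).
    have := pF m _ (leqnSn _) At2; nra.
  have h2 : F m t <= F m s.
    have [y /andP[y1 y2] yE] := @mvt_is_derive (F m) (F m.+1) A t s
      (fun t => dF m t (leqnn _)) At' gts.
    by have := pF m.+1 _ (leqnn _) (lt_trans At' y1); nra.
  have h3 : s <= m.+2%:R * t by rewrite -natr1 mulrDl mul1r; nra.
  have t_gt0 : 0 < t by lra.
  rewrite -(ler_pM2l t_gt0) (le_trans h1)//.
  have h4 : F m s <= C * (m.+2%:R * t) * F m.+1 s.
    rewrite (le_trans (b1 _ As))// ler_pM2r// ler_pM2l//.
  have : 2 * C * F m t <= 2 * C * (C * (m.+2%:R * t) * F m.+1 s).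
    by rewrite ler_pM2l ?mulr_gt0// (le_trans h2).
  move/le_trans; apply; rewrite /D le_eqVlt; apply/orP; left; apply/eqP.
  by set w := m.+2%:R; ring.
pose n0 := (Num.truncn (2 * A)).+1.
have n0P n : (n0 <= n)%N -> 2 * A < n%:R.
  by move=> n0n; rewrite (lt_le_trans (truncnS_gt _))// ler_nat.
have AAn n : (n0 <= n)%N -> A < n%:R by move=> /n0P; lra.
have mv k n : (k <= m.+1)%N -> (n0 <= n)%N ->
    exists2 x, n%:R <= x <= n%:R + k%:R & iter k (@fdiff R) (fun n => f n%:R) n = F k x.
  move=> km /AAn An; apply: (@iter_fdiff_derive k F A) => // j t jk.
  by apply: dF; exact: leq_trans jk km.
exists (C * m.+2%:R * D), n0 => n n0n; split.
- move=> k km; have [x /andP[nx _] ->] := mv k n km n0n.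
  by apply: pF => //; apply: lt_le_trans nx; exact: AAn.
- have [x /andP[nx xn] ->] := mv m.+1 n (leqnn _) n0n.
  have [y /andP[ny yn] ->] := mv m n (leqnSn _) n0n.
  (* The intermediate points x and y of the two orders are unrelated. Both lie to the left of z: F_m
     grows from y to z, [b1] is applied at z, and [b3] returns from z to x. *)
  pose z : R := n%:R + m.+1%:R.
  have An := AAn _ n0n.
  have nz : n%:R <= z by rewrite lerDl.
  have yz : y < z by rewrite (le_lt_trans yn)// ltrD2l ltr_nat.
  have [w /andP[w1 w2] wE] := @mvt_is_derive (F m) (F m.+1) A y z
    (fun t => dF m t (leqnn _)) (lt_le_trans An ny) yz.
  have h1 : F m y <= F m z.
    have := pF m.+1 _ (leqnn _) (lt_trans (lt_le_trans An ny) w1); nra.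
  have h2 := b1 _ (lt_le_trans An nz).
  have [||h3|] := b3 x z.
  + by rewrite (lt_le_trans (n0P _ n0n)).
  + by rewrite (le_trans xn)// lerDl.
  + have h4 : z <= m.+2%:R * n%:R.
      have : 1 <= n%:R :> R by lra.
      by rewrite /z -[m.+2%:R]natr1; have : 0 <= m.+1%:R :> R by []; nra.
    have Fz := pF m.+1 _ (leqnn _) (lt_le_trans An nz).
    rewrite (le_trans h1)// (le_trans h2)//.
    have : C * z * F m.+1 z <= C * (m.+2%:R * n%:R) * (D * F m.+1 x).
      have Cz0 : 0 <= C * z by rewrite mulr_ge0 ?(ltW C0)//; lra.
      by apply: ler_pM; [exact: Cz0|exact: ltW|rewrite ler_pM2l|exact: h3].
    move/le_trans; apply; rewrite le_eqVlt; apply/orP; left; apply/eqP.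
    set q := F m.+1 x; clearbody q D; ring.
  + by lra.
- move=> s ns; have n0s := leq_trans n0n ns.
  have [x /andP[sx xs] ->] := mv m.+1 s (leqnn _) n0s.
  have [y /andP[ny yn] ->] := mv m.+1 n (leqnn _) n0n.
  have nsR : n%:R <= s%:R :> R by rewrite ler_nat.
  have Fy := pF m.+1 _ (leqnn _) (lt_le_trans (AAn _ n0n) ny).
  have [||h3|] := b3 y x.
  + by rewrite (lt_le_trans (n0P _ n0s)).
  + by rewrite (le_trans yn)// lerD2r (le_trans nsR).
  + rewrite (le_trans h3)// ler_pM2r// ler_peMl//.
      by rewrite (le_trans _ D_ge)// ltW.
    have : 1 <= m.+2%:R :> R by rewrite ler1n.
    nra.
  + by have := AAn _ n0n; lra.
Qed.

End Derivatives.

(** * The mean ergodic theorem *)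

Section Complete.
Variables (R : realType) (H : completeNormedModType R[i]).

Lemma nrm_cauchy (u_ : nat -> H) :
  (forall e, 0 < e -> exists n0, forall k l, (n0 <= k)%N -> (n0 <= l)%N ->
     nrm (u_ k - u_ l) <= e) ->
  exists z, forall e, 0 < e -> exists n0, forall k, (n0 <= k)%N ->
     nrm (u_ k - z) <= e.
Proof.
move=> uC; have uc : cvg (u_ @ \oo).
  apply: cauchy_cvg; apply/cauchy_exP => -[e ei].
  rewrite ltcE /= => /andP[/eqP-> e0].
  have [n0 n0P] := uC _ (divr_gt0 e0 (ltr0n _ 2)).
  exists (u_ n0), n0 => // n /= n0n; rewrite -ball_normE /= nrmE ltC_real.
  by rewrite (le_lt_trans (n0P _ _ _ _))// ltr_pdivrMr// ltr_pMr// ltr1n.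
exists (lim (u_ @ \oo)) => e e0.
have ec0 : 0 < (e%:C : R[i]) by rewrite ltC_real.
have /cvgrPdist_le/(_ _ ec0)[n0 _ n0P] := uc.
by exists n0 => k n0k; have := n0P k n0k; rewrite nrmE leC_real nrmB.
Qed.

End Complete.

(** * Orbit sums of a power bounded operator *)

Section PowerBounded.
Variables (R : realType) (H : normedModType R[i]) (T : {linear H -> H}).
Implicit Types (u v x : H) (r : R).

Lemma iter_linD n u v : iter n T (u + v) = iter n T u + iter n T v.
Proof. by elim: n => //= n ->; rewrite linearD. Qed.

Lemma iter_linB n u v : iter n T (u - v) = iter n T u - iter n T v.
Proof. by elim: n => //= n ->; rewrite linearB. Qed.

Lemma iter_linZ n (a : R[i]) u : iter n T (a *: u) = a *: iter n T u.
Proof. by elim: n => //= n ->; rewrite linearZ. Qed.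

Lemma iter0v n : iter n T 0 = 0.
Proof. by elim: n => //= n ->; rewrite linear0. Qed.

Lemma iter_sum (I : Type) (s : seq I) (P : pred I) (F : I -> H) n :
  iter n T (\sum_(i <- s | P i) F i) = \sum_(i <- s | P i) iter n T (F i).
Proof. by elim/big_rec2: _ => [|i y z _ <-]; rewrite ?iter0v ?iter_linD. Qed.

Variable M : R.
Hypothesis T_bound : forall n v, nrm (iter n T v) <= M * nrm v.
Hypothesis M1 : 1 <= M.

Let M0 : 0 < M. Proof. exact: lt_le_trans M1. Qed.
Let M_ge0 : 0 <= M. Proof. exact: ltW. Qed.

Definition orbit_sum n v : H := \sum_(j < n) iter j T v.

Lemma orbit_sumB n u v : orbit_sum n (u - v) = orbit_sum n u - orbit_sum n v.
Proof. by rewrite /orbit_sum -sumrB; apply: eq_bigr => i _; rewrite iter_linB. Qed.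

Lemma orbit_sumD n u v : orbit_sum n (u + v) = orbit_sum n u + orbit_sum n v.
Proof. by rewrite /orbit_sum -big_split; apply: eq_bigr => i _; rewrite iter_linD. Qed.

Lemma orbit_sumZ n (a : R[i]) u : orbit_sum n (a *: u) = a *: orbit_sum n u.
Proof. by rewrite /orbit_sum scaler_sumr; apply: eq_bigr => i _; rewrite iter_linZ. Qed.

Lemma orbit_sum_sum n m (F : 'I_m -> H) :
  orbit_sum n (\sum_(i < m) F i) = \sum_(i < m) orbit_sum n (F i).
Proof.
rewrite /orbit_sum exchange_big /=; apply: eq_bigr => i _.
by rewrite iter_sum.
Qed.

Lemma nrm_orbit_sum n v : nrm (orbit_sum n v) <= n%:R * (M * nrm v).
Proof.
rewrite /orbit_sum -(big_mkord xpredT (fun j => iter j T v)).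
by rewrite -{2}[n]subn0; apply: nrm_sum_const => i _.
Qed.

Lemma orbit_sum_increment n v : orbit_sum n (T v - v) = iter n T v - v.
Proof.
rewrite orbit_sumB /orbit_sum -sumrB.
rewrite -(big_mkord xpredT (fun j => iter j T (T v) - iter j T v)).
under eq_bigr do rewrite -iterSr.
by rewrite telescope_sumr.
Qed.

(** The vector T^k v - v is a sum of k coboundaries, and the orbit sum of each telescopes to two
    terms; hence the bound does not grow with n. *)
Lemma orbit_sum_shift n k v :
  nrm (orbit_sum n (iter k T v - v)) <= k%:R * (2 * M * nrm v).
Proof.
have -> : iter k T v - v = \sum_(i < k) (T (iter i T v) - iter i T v).
  rewrite -(big_mkord xpredT (fun i => T (iter i T v) - iter i T v)).
  by rewrite telescope_sumr.
rewrite orbit_sum_sum; under eq_bigr do rewrite orbit_sum_increment -iterD.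
rewrite -(big_mkord xpredT (fun i => iter (n + i) T v - iter i T v)).
rewrite -{2}[k]subn0; apply: nrm_sum_const => i _.
by rewrite (le_trans (nrmBD _ _))// -mulrA mulr_natl mulr2n lerD.
Qed.

(** The ergodic averages of [v] tend to 0 in norm. *)
Definition negligible v := forall e, 0 < e -> exists n0, forall n, (n0 <= n)%N ->
  nrm (orbit_sum n v) <= n%:R * e.

Lemma negligibleD u v : negligible u -> negligible v -> negligible (u + v).
Proof.
move=> hu hv e e0; have e2 : 0 < e / 2 by rewrite divr_gt0.
have [n1 h1] := hu _ e2; have [n2 h2] := hv _ e2.
exists (maxn n1 n2) => n; rewrite geq_max => /andP[n1n n2n].
rewrite orbit_sumD (le_trans (nrmD _ _))//.
by have := h1 _ n1n; have := h2 _ n2n; lra.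
Qed.

Lemma negligibleZ (a : R[i]) v : negligible v -> negligible (a *: v).
Proof.
move=> hv e e0; have e2 : 0 < e / (cabs a + 1).
  by rewrite divr_gt0// ltr_wpDl// cabs_ge0.
have [n0 h] := hv _ e2; exists n0 => n /h hn; rewrite orbit_sumZ nrmZ.
have a0 := cabs_ge0 a.
rewrite (le_trans (ler_wpM2l a0 hn))// mulrCA ler_wpM2l//.
by rewrite mulrA ler_pdivrMr 1?mulrC ?ler_pM2l//; lra.
Qed.

Lemma negligible_bounded v (B : R) :
  (forall n, nrm (orbit_sum n v) <= B) -> negligible v.
Proof.
move=> hB e e0; exists (Num.truncn (`|B| / e)).+1 => n h.
rewrite (le_trans (hB n))// (le_trans (ler_norm _))// -ler_pdivrMr//.
by rewrite (le_trans (ltW (truncnS_gt _)))// ler_nat.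
Qed.

(* Near-fixed vectors with the same ergodic averages as [x]: a convex set,
   decreasing with [d], whose elements of almost minimal norm converge to a
   fixed vector. *)
Definition near_fixed d x v := nrm (T v - v) <= d /\ negligible (v - x).

(** The witness is the ergodic average of length K: [T] moves it by (T^K x - x) / K, and it differs
    from [x] by an average of the vectors T^j x - x, whose orbit sums stay bounded. *)
Lemma near_fixed_average d x : 0 < d ->
  exists2 v, near_fixed d x v & nrm v <= M * nrm x.
Proof.
move=> d0; pose B := 2 * M * nrm x.
have B0 : 0 <= B by rewrite !mulr_ge0 ?nrm_ge0.
pose K := (Num.truncn (B / d)).+1.
have K0 : 0 < K%:R :> R by rewrite ltr0n.
have BK : B / d <= K%:R by rewrite ltW// truncnS_gt.
have KV v : nrm ((K%:R^-1)%:C *: v) = nrm v / K%:R.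
  by rewrite nrmZ_real ger0_norm ?invr_ge0// mulrC.
exists ((K%:R^-1)%:C *: orbit_sum K x); last first.
  by rewrite KV ler_pdivrMr// mulrC nrm_orbit_sum.
split.
  have -> : T ((K%:R^-1)%:C *: orbit_sum K x) - (K%:R^-1)%:C *: orbit_sum K x =
      (K%:R^-1)%:C *: (iter K T x - x).
    rewrite linearZ -scalerBr -orbit_sum_increment orbit_sumB.
    congr (_ *: (_ - _)); rewrite /orbit_sum linear_sum.
    by apply: eq_bigr => i _; rewrite -iterSr.
  rewrite KV ler_pdivrMr//; move: BK; rewrite ler_pdivrMr// mulrC => /(le_trans _); apply.
  rewrite (le_trans (nrmBD _ _))// /B -mulrA mulr_natl mulr2n lerD//.
  by rewrite ler_peMl ?nrm_ge0.
have -> : (K%:R^-1)%:C *: orbit_sum K x - x =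
    (K%:R^-1)%:C *: \sum_(j < K) (iter j T x - x).
  rewrite sumrB scalerBr sumr_const card_ord; congr (_ - _).
  rewrite -[x *+ _]scaler_nat scalerA fmorphV rmorph_nat mulVf ?scale1r//.
  by rewrite pnatr_eq0.
apply/negligibleZ/(@negligible_bounded _ (K%:R * (K%:R * B))) => n.
rewrite orbit_sum_sum -(big_mkord xpredT (fun j => orbit_sum n (iter j T x - x))).
rewrite -{2}[K]subn0; apply: nrm_sum_const => i /andP[_ iK].
by rewrite (le_trans (orbit_sum_shift _ _ _))// ler_wpM2r// ler_nat ltnW.
Qed.

Lemma near_fixed_mid d d' x u v : d' <= d -> near_fixed d x u ->
  near_fixed d' x v -> near_fixed d x ((2^-1)%:C *: (u + v)).
Proof.
move=> dd [u1 u2] [v1 v2]; split.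
  have -> : T ((2^-1)%:C *: (u + v)) - (2^-1)%:C *: (u + v) =
      (2^-1)%:C *: ((T u - u) + (T v - v)).
    by rewrite linearZ -scalerBr (linearD T) opprD addrACA.
  rewrite nrmZ_real ger0_norm ?invr_ge0//.
  by have := nrmD (T u - u) (T v - v); lra.
have -> : (2^-1)%:C *: (u + v) - x = (2^-1)%:C *: ((u - x) + (v - x)).
  rewrite addrACA -opprD scalerBr -mulr2n -[x *+ _]scaler_nat scalerA; congr (_ - _).
  by rewrite fmorphV rmorph_nat mulVf ?scale1r// pnatr_eq0.
exact/negligibleZ/negligibleD.
Qed.

End PowerBounded.

Section MeanErgodic.
Variables (R : realType) (H : completeNormedModType R[i]).
Variable dot : {dot H for Num.conj}.
Hypothesis dot_norm : forall x : H, dot x x = `|x| ^+ 2.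
Variables (T : {linear H -> H}) (M : R).
Hypothesis T_bound : forall n v, nrm (iter n T v) <= M * nrm v.
Hypothesis M1 : 1 <= M.
Hypothesis T_fix : forall v, T v = v -> v = 0.

Let M0 : 0 < M. Proof. exact: lt_le_trans M1. Qed.

(** The infima [m k] of the norms of near-fixed vectors increase to a finite limit [L]. Almost
    minimal vectors [v_ k] form a Cauchy sequence by the parallelogram law, since midpoints stay
    near-fixed. Their limit is fixed by [T], hence zero, so [x] is a vector of small norm minus a
    negligible one. *)
Lemma mean_ergodic x : negligible T x.
Proof.
pose d (k : nat) : R := k.+1%:R^-1.
have d_gt0 k : 0 < d k by rewrite invr_gt0.
have d_dec k l : (k <= l)%N -> d l <= d k.
  by move=> kl; rewrite lef_pV2 ?posrE// ler_nat ltnS.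
have d_small e : 0 < e -> exists n0, forall k, (n0 <= k)%N -> d k <= e.
  move=> e0; exists (Num.truncn e^-1) => k h.
  rewrite -[e]invrK lef_pV2 ?posrE ?invr_gt0// ltW//.
  by rewrite (lt_le_trans (truncnS_gt _))// ler_nat ltnS.
pose S k := [set nrm v | v in near_fixed T (d k) x].
pose m k := inf (S k).
have S_inf k : has_inf (S k).
  split; last by exists 0 => _ [v _ <-]; exact: nrm_ge0.
  have [v vG _] := near_fixed_average T_bound M1 x (d_gt0 k).
  by exists (nrm v), v.
have m_le k v : near_fixed T (d k) x v -> m k <= nrm v.
  by move=> vG; apply: ge_inf; [have [] := S_inf k|exists v].
have m_ge0 k : 0 <= m k.
  by apply: lb_le_inf; [have [] := S_inf k|move=> _ [v _ <-]; exact: nrm_ge0].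
have m_mono k l : (k <= l)%N -> m k <= m l.
  move=> kl; apply: lb_le_inf; first by have [] := S_inf l.
  by move=> _ [v [v1 v2] <-]; apply: m_le; split => //; rewrite (le_trans v1) ?d_dec.
have m_sup : has_sup (range m).
  split; first by exists (m 0%N), 0%N.
  exists (M * nrm x) => _ [k _ <-].
  have [v vG vM] := near_fixed_average T_bound M1 x (d_gt0 k).
  by rewrite (le_trans (m_le _ _ vG)).
pose L := sup (range m).
have m_L k : m k <= L by apply: sup_upper_bound => //; exists k.
have L0 : 0 <= L := le_trans (m_ge0 0%N) (m_L 0%N).
have /choice[v_ v_P] : forall k, exists v, near_fixed T (d k) x v /\ nrm v < m k + d k.
  move=> k; have [_ [v vG <-] vm] := inf_adherent (d_gt0 k) (S_inf k).
  by exists v.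
have [z zP] : exists z, forall e, 0 < e -> exists n0, forall k, (n0 <= k)%N ->
     nrm (v_ k - z) <= e.
  apply: nrm_cauchy => e e0.
  (* Both norms are at most L + h and the midpoint has norm at least L - h, so the squared distance
     is at most 4 (L + h)^2 - 4 (L - h)^2 = 16 L h. The cap h <= 1 settles the case L <= h, where
     the bound is 16 h^2. *)
  pose h := Num.min 1 (e ^+ 2 / (16 * (L + 1))).
  have L1 : 0 < L + 1 by rewrite ltr_wpDl.
  have h0 : 0 < h by rewrite lt_min ltr01 divr_gt0 ?exprn_gt0 ?mulr_gt0.
  have h1 : h <= 1 by rewrite ge_min lexx.
  have he : 16 * (L + 1) * h <= e ^+ 2.
    by rewrite mulrC -ler_pdivlMr ?mulr_gt0// ge_min lexx orbT.
  have [_ [k0 _ <-] k0P] := sup_adherent h0 m_sup.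
  have [n0 n0P] := d_small _ h0.
  have main k l : (maxn k0 n0 <= k)%N -> (k <= l)%N -> nrm (v_ k - v_ l) <= e.
    rewrite geq_max => /andP[k0k n0k] kl; have n0l := leq_trans n0k kl.
    have [G1 N1] := v_P k; have [G2 N2] := v_P l.
    have := m_le _ _ (near_fixed_mid (d_dec _ _ kl) G1 G2).
    rewrite nrmZ_real ger0_norm ?invr_ge0// mulrC ler_pdivlMr// => mid.
    rewrite -(@ler_pXn2r _ 2) ?nnegrE ?nrm_ge0 ?(ltW e0)//.
    apply: le_trans he; have := parallelogram dot_norm (v_ k) (v_ l).
    have := m_mono _ _ k0k; have := m_L l; have := n0P _ n0k; have := n0P _ n0l.
    have Lh : 0 <= L + h by rewrite addr_ge0// ltW.
    have : nrm (v_ k) ^+ 2 <= (L + h) ^+ 2.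
      rewrite ler_pXn2r ?nnegrE ?nrm_ge0 ?Lh//.
      by have := m_L k; have := n0P _ n0k; lra.
    have : nrm (v_ l) ^+ 2 <= (L + h) ^+ 2.
      rewrite ler_pXn2r ?nnegrE ?nrm_ge0 ?Lh//.
      by have := m_L l; have := n0P _ n0l; lra.
    have := m_ge0 k; rewrite -/L in k0P; move: mid.
    set a := nrm (v_ k + v_ l); set b := nrm (v_ k - v_ l).
    set p := nrm (v_ k) ^+ 2; set q := nrm (v_ l) ^+ 2.
    move=> mid mk p1 q1 dl dk mLl mm par.
    have a0 : 0 <= a by exact: nrm_ge0.
    have [hL|hL] := leP L h; first by nra.
    have : (2 * (L - h)) ^+ 2 <= a ^+ 2.
      by rewrite ler_pXn2r ?nnegrE//; lra.
    nra.
  exists (maxn k0 n0) => k l hk hl; have [kl|/ltnW lk] := leqP k l.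
    exact: main.
  by rewrite nrmB; exact: main.
have Tz : T z = z.
  apply/eqP; rewrite -subr_eq0; apply/eqP/nrm_eq0/eqP.
  rewrite eq_le nrm_ge0 andbT; apply/ler_addgt0Pr => e e0; rewrite add0r.
  (* The three pieces of T z - z below are bounded by M h, h and h. *)
  pose h := e / (M + 2); have h0 : 0 < h by rewrite divr_gt0// ltr_wpDl// ltW.
  have [n1 H1] := zP _ h0; have [n2 H2] := d_small _ h0.
  pose k := maxn n1 n2; have {}H1 := H1 k (leq_maxl _ _).
  have {}H2 := H2 k (leq_maxr _ _); have [[G1 _] _] := v_P k.
  have -> : T z - z = T (z - v_ k) + (T (v_ k) - v_ k) + (v_ k - z).
    by rewrite linearB /= !addrA subrK subrK.
  have := T_bound 1 (z - v_ k); rewrite nrmB /= => G2.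
  have : e = (M + 2) * h by rewrite mulrC divfK// gt_eqF// ltr_wpDl// ltW.
  have := nrmD (T (z - v_ k) + (T (v_ k) - v_ k)) (v_ k - z).
  have := nrmD (T (z - v_ k)) (T (v_ k) - v_ k).
  have : M * nrm (v_ k - z) <= M * h by rewrite ler_pM2l.
  by lra.
move/T_fix: Tz => z0; move=> e e0.
have eM : 0 < e / (2 * M) by rewrite divr_gt0 ?mulr_gt0.
have [n1 H1] := zP _ eM; have {H1} := H1 _ (leqnn n1); rewrite z0 subr0 => H1.
have [[_ G] _] := v_P n1; have e2 : 0 < e / 2 by rewrite divr_gt0.
have [n2 H2] := G _ e2; exists n2 => n /H2 {}H2.
have -> : x = v_ n1 - (v_ n1 - x) by rewrite opprB addrC subrK.
rewrite orbit_sumB (le_trans (nrmBD _ _))//.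
have H3 : M * nrm (v_ n1) <= e / 2.
  by move: H1; rewrite ler_pdivlMr ?mulr_gt0//; lra.
have := nrm_orbit_sum T_bound n (v_ n1).
have : n%:R * (M * nrm (v_ n1)) <= n%:R * (e / 2) by rewrite ler_wpM2l.
by lra.
Qed.

End MeanErgodic.

(** * The exponential on the unit circle *)

Section Exponential.
Variable R : realType.
Implicit Types s t : R.

Lemma e2piiD s t : e2pii (s + t) = e2pii s * e2pii t.
Proof.
rewrite /e2pii mulrDr cosD sinD; apply/eqP; rewrite eq_complex /=.
by rewrite eqxx addrC eqxx.
Qed.

Lemma e2pii0 : e2pii (0 : R) = 1.
Proof. by rewrite /e2pii mulr0 cos0 sin0. Qed.

Lemma e2piiMn t n : e2pii (n%:R * t) = e2pii t ^+ n.
Proof.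
elim: n => [|n IH]; first by rewrite mul0r e2pii0.
by rewrite -natr1 mulrDl mul1r e2piiD IH exprSr.
Qed.

Lemma e2pii1 : e2pii (1 : R) = 1.
Proof. by rewrite /e2pii mulr1 mulr_natl cos2pi sin2pi. Qed.

Lemma e2pii_nat n : e2pii (n%:R : R) = 1.
Proof. by rewrite -[n%:R]mulr1 e2piiMn e2pii1 expr1n. Qed.

Lemma conj_e2pii t : Num.conj (e2pii t) = e2pii (- t).
Proof. by rewrite /e2pii mulrN cosN sinN. Qed.

Lemma cabs_e2pii t : cabs (e2pii t) = 1.
Proof. by rewrite /cabs normc_def /= cos2Dsin2 sqrtr1. Qed.

Lemma e2piiN t : e2pii (- t) * e2pii t = 1.
Proof. by rewrite -e2piiD addNr e2pii0. Qed.

(** The cosine is injective on [0, pi], which covers |t| <= 1/2; for larger |t| the angle is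
    reflected to 1 - |t|, which would have to vanish. *)
Lemma e2pii_eq1 t : `|t| < 1 -> e2pii t = 1 -> t = 0.
Proof.
move=> t1 /eqP; rewrite eq_complex /= => /andP[/eqP + _].
have -> : cos (2 * pi * t) = cos (2 * pi * `|t|).
  by case: (ger0P t) => // _; rewrite mulrN cosN.
have pi0 := pi_gt0 R; move: (normr_ge0 t) => t0.
have inj s : 0 <= s -> s <= 2^-1 -> cos (2 * pi * s) = 1 -> s = 0.
  move=> s0 s1 c; have : 2 * pi * s = 0.
    have h : 2 * pi * s \in `[0, pi] by rewrite in_itv /=; apply/andP; split; nra.
    by apply: (cos_inj h); [rewrite in_itv /= lexx ltW|rewrite cos0].
  by move/eqP; rewrite !mulf_eq0 pnatr_eq0 (gt_eqF pi0) /= => /eqP.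
have [th|th] := leP `|t| 2^-1; first by move=> /(inj _ t0 th)/normr0P/eqP.
have -> : cos (2 * pi * `|t|) = cos (2 * pi * (1 - `|t|)).
  by rewrite -[LHS]cosN -[LHS]cosD2pi; congr cos; rewrite -mulr_natl; ring.
by move=> /inj; lra.
Qed.

Lemma e2pii_continuous t e : 0 < e ->
  \forall s \near t, cabs (e2pii s - e2pii t) <= e.
Proof.
move=> e0; have e2 : 0 < e / 2 by rewrite divr_gt0.
have lin : continuous (fun s : R => 2 * pi * s).
  by move=> s; apply: cvgMr; exact: cvg_id.
have cc : (fun s => cos (2 * pi * s)) @ t --> cos (2 * pi * t).
  by apply: (continuous_cvg _ (h := cos)); [exact: continuous_cos|exact: lin].
have cs : (fun s => sin (2 * pi * s)) @ t --> sin (2 * pi * t).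
  by apply: (continuous_cvg _ (h := sin)); [exact: continuous_sin|exact: lin].
move/cvgrPdist_le : cc => /(_ _ e2); move/cvgrPdist_le : cs => /(_ _ e2).
apply: filterS2 => s s1 s2.
have -> : e2pii s - e2pii t = (cos (2 * pi * s) - cos (2 * pi * t))%:C
   + 'i%C * (sin (2 * pi * s) - sin (2 * pi * t))%:C.
  by apply/eqP; rewrite eq_complex /=; apply/andP; split; apply/eqP; ring.
rewrite (le_trans (cabsD _ _))// cabsM !cabs_real.
have -> : cabs ('i%C : R[i]) = 1 by rewrite /cabs normc_def /= expr0n expr1n add0r sqrtr1.
by move: s1 s2; rewrite distrC (distrC (cos _)); lra.
Qed.

Lemma cabsXB (a b : R[i]) n : cabs a = 1 -> cabs b = 1 ->
  cabs (a ^+ n - b ^+ n) <= n%:R * cabs (a - b).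
Proof.
move=> a1 b1; elim: n => [|n IH].
  by rewrite !expr0 subrr mul0r /cabs normr0.
rewrite !exprSr (_ : _ - _ = a ^+ n * (a - b) + (a ^+ n - b ^+ n) * b); last by ring.
rewrite (le_trans (cabsD _ _))// !cabsM cabsX a1 b1 expr1n mul1r mulr1.
by rewrite -natr1 mulrDl mul1r addrC lerD2r.
Qed.

End Exponential.

(** * Ergodic averages uniformly over rotations of the operator *)

Section Uniform.
Variables (R : realType) (H : completeNormedModType R[i]).
Variable dot : {dot H for Num.conj}.
Hypothesis dot_norm : forall x : H, dot x x = `|x| ^+ 2.
Variables (T : {linear H -> H}) (M : R).
Hypothesis T_bound : forall n v, nrm (iter n T v) <= M * nrm v.
Hypothesis M1 : 1 <= M.
Hypothesis T_eig : forall t v, T v = e2pii t *: v -> v = 0.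

Let M0 : 0 < M. Proof. exact: lt_le_trans M1. Qed.

Definition rotate (t : R) : {linear H -> H} := e2pii t \*: T.

Lemma iter_rotate t n v : iter n (rotate t) v = e2pii t ^+ n *: iter n T v.
Proof.
elim: n => [|n IH]; first by rewrite expr0 scale1r.
by rewrite !iterS IH /= linearZ scalerA -exprS.
Qed.

Lemma rotate_bound t n v : nrm (iter n (rotate t) v) <= M * nrm v.
Proof. by rewrite iter_rotate nrmZ cabsX cabs_e2pii expr1n mul1r. Qed.

Lemma rotate_negligible t x : negligible (rotate t) x.
Proof.
apply: (mean_ergodic dot_norm (rotate_bound t) M1) => v /= tv.
apply: (T_eig (t := - t)).
by rewrite -{2}tv scalerA e2piiN scale1r.
Qed.

(** The orbit sum of length n of [orbit_sum S k x] is almost k times that of [x]. Thus one length k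
    with a small average controls all large n, with an error independent of n. *)
Lemma orbit_sum_compare t n k x :
  k%:R * nrm (orbit_sum (rotate t) n x) <=
  n%:R * (M * nrm (orbit_sum (rotate t) k x)) + k%:R * (k%:R * (2 * M * nrm x)).
Proof.
set S := rotate t.
have -> : k%:R * nrm (orbit_sum S n x) = nrm (k%:R%:C *: orbit_sum S n x).
  by rewrite nrmZ_real ger0_norm.
have -> : (k%:R)%:C *: orbit_sum S n x = orbit_sum S n (orbit_sum S k x) -
    \sum_(i < k) orbit_sum S n (iter i S x - x).
  rewrite -orbit_sum_sum sumrB orbit_sumB opprB addrC subrK.
  by rewrite sumr_const card_ord rmorph_nat -[x *+ k]scaler_nat orbit_sumZ.
rewrite (le_trans (nrmBD _ _))// lerD//.
  exact: (nrm_orbit_sum (rotate_bound t)).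
rewrite -(big_mkord xpredT (fun i => orbit_sum S n (iter i S x - x))).
rewrite -{2}[k]subn0; apply: nrm_sum_const => i /andP[_ ik].
rewrite (le_trans (orbit_sum_shift (rotate_bound t) _ _ _))//.
by rewrite ler_wpM2r ?mulr_ge0 ?nrm_ge0 ?(ltW M0)// ler_nat ltnW.
Qed.

Lemma orbit_sum_near s t k x :
  nrm (orbit_sum (rotate s) k x) <= nrm (orbit_sum (rotate t) k x) +
    k%:R * (k%:R * cabs (e2pii s - e2pii t) * (M * nrm x)).
Proof.
have -> : orbit_sum (rotate s) k x = orbit_sum (rotate t) k x +
    (orbit_sum (rotate s) k x - orbit_sum (rotate t) k x) by rewrite addrC subrK.
rewrite (le_trans (nrmD _ _))// lerD2l /orbit_sum -sumrB.
rewrite -(big_mkord xpredT (fun i => iter i (rotate s) x - iter i (rotate t) x)).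
rewrite -{2}[k]subn0; apply: nrm_sum_const => i /andP[_ ik].
rewrite !iter_rotate -scalerBl nrmZ ler_pM ?cabs_ge0 ?nrm_ge0//.
rewrite (le_trans (cabsXB _ (cabs_e2pii s) (cabs_e2pii t)))//.
by rewrite ler_wpM2r ?cabs_ge0// ler_nat ltnW.
Qed.

(** Compactness of [0, 1]. Near a given t, the average of one fixed length k stays small by
    continuity, and [orbit_sum_compare] extends the bound to all large n with a common threshold. *)
Lemma uniform_negligible x e : 0 < e ->
  exists n0, forall n, (n0 <= n)%N -> forall t, 0 <= t <= 1 ->
    nrm (orbit_sum (rotate t) n x) <= n%:R * e.
Proof.
move=> e0.
have := @segment_compact R 0 1; rewrite compact_near_coveringP => /(_ nat \oo
  (fun n t => nrm (orbit_sum (rotate t) n x) <= n%:R * e)).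
case=> [t _|n0 _ h]; last first.
  by exists n0 => n n0n t t01; apply: (h n n0n t); rewrite /= in_itv.
have e4 : 0 < e / (4 * M) by rewrite divr_gt0 ?mulr_gt0.
have [k0 k0P] := rotate_negligible t x e4.
pose k := k0.+1; have {k0P} kP := k0P k (leqnSn _).
(* The bound e / (4 M) at t and an equal error for moving to s give e / (2 M) at s, which
   contributes e / 2 after multiplication by M; the other half is the boundary term, handled by
   [n0]. The summand 1 keeps [B] positive when x = 0. *)
pose B := k%:R * (M * nrm x) + 1.
have B0 : 0 < B by rewrite ltr_wpDl// !mulr_ge0 ?nrm_ge0 ?(ltW M0).
have eB : 0 < e / (4 * M * B) by rewrite divr_gt0 ?mulr_gt0.
have kR : 0 < k%:R :> R by rewrite ltr0n.
pose n0 := (Num.truncn (4 * k%:R * M * nrm x / e)).+1.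
exists ([set s : R | cabs (e2pii s - e2pii t) <= e / (4 * M * B)],
        [set n | (n0 <= n)%N]) => /=.
  by split; [exact: e2pii_continuous|exists n0].
case=> s n /= [st n0n].
rewrite -(ler_pM2l kR) (le_trans (orbit_sum_compare _ _ _ _))//.
have h1 : nrm (orbit_sum (rotate s) k x) <= k%:R * (e / (2 * M)).
  rewrite (le_trans (orbit_sum_near s t k x))//.
  have -> : k%:R * (e / (2 * M)) = k%:R * (e / (4 * M)) + k%:R * (e / (4 * M)).
    by field; rewrite gt_eqF.
  rewrite lerD// ler_pM2l// mulrAC.
  have : B * cabs (e2pii s - e2pii t) <= B * (e / (4 * M * B)) by rewrite ler_pM2l.
  have -> : B * (e / (4 * M * B)) = e / (4 * M) by field; rewrite !gt_eqF.
  by apply: le_trans; rewrite ler_wpM2r ?cabs_ge0// lerDl.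
have h2 : 4 * k%:R * M * nrm x <= n%:R * e.
  rewrite -ler_pdivrMr// (le_trans (ltW (truncnS_gt _)))// ler_nat.
  exact: n0n.
have h3 : n%:R * (M * nrm (orbit_sum (rotate s) k x)) <= n%:R * (k%:R * e / 2).
  rewrite ler_wpM2l// mulrC -ler_pdivlMr// (le_trans h1)// le_eqVlt.
  by apply/orP; left; apply/eqP; field; rewrite gt_eqF.
have h4 : k%:R * (4 * k%:R * M * nrm x) <= k%:R * (n%:R * e) by rewrite ler_pM2l.
by lra.
Qed.

End Uniform.

(** * Arbitrary bounded weights *)

Section Parseval.
Variables (R : realType) (H : normedModType R[i]).
Variable dot : {dot H for Num.conj}.
Hypothesis dot_norm : forall x : H, dot x x = `|x| ^+ 2.

Lemma sum_roots_of_unity Q j l : (j < Q)%N -> (l < Q)%N ->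
  \sum_(k < Q) e2pii (k%:R / Q%:R : R) ^+ j * Num.conj (e2pii (k%:R / Q%:R) ^+ l)
  = if j == l then Q%:R else 0.
Proof.
move=> jQ lQ; have Q0 : 0 < Q%:R :> R by rewrite ltr0n (leq_ltn_trans _ jQ).
pose t : R := (j%:R - l%:R) / Q%:R.
transitivity (\sum_(k < Q) e2pii t ^+ k).
  apply: eq_bigr => k _; rewrite -!e2piiMn conj_e2pii -e2piiD; congr e2pii.
  by rewrite /t; field; rewrite gt_eqF.
have [jl|jl] := eqVneq j l.
  rewrite /t jl subrr mul0r e2pii0; under eq_bigr do rewrite expr1n.
  by rewrite sumr_const card_ord.
have : (e2pii t - 1) * \sum_(k < Q) e2pii t ^+ k = 0.
  rewrite -subrX1 -e2piiMn mulrC /t divfK ?gt_eqF// e2piiD -conj_e2pii.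
  by rewrite !e2pii_nat conjC1 mulr1 subrr.
move/eqP; rewrite mulf_eq0 => /orP[|/eqP//].
rewrite subr_eq0 => /eqP/e2pii_eq1 t0; exfalso; move/eqP: jl; apply.
apply/eqP; rewrite -(eqr_nat R) -subr_eq0; apply/eqP.
have : t = 0.
  apply: t0; rewrite normrM normfV (ger0_norm (ltW Q0)) ltr_pdivrMr// mul1r.
  have jR : j%:R < Q%:R :> R by rewrite ltr_nat.
  have lR : l%:R < Q%:R :> R by rewrite ltr_nat.
  have j0 : 0 <= j%:R :> R by [].
  have l0 : 0 <= l%:R :> R by [].
  by rewrite ltr_norml; apply/andP; split; lra.
by move/eqP; rewrite mulf_eq0 invr_eq0 (gt_eqF Q0) orbF => /eqP.
Qed.

Lemma Re_sum (I : Type) (s : seq I) (P : pred I) (F : I -> R[i]) :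
  complex.Re (\sum_(i <- s | P i) F i) = \sum_(i <- s | P i) complex.Re (F i).
Proof. by elim/big_rec2: _ => [|i y z _ <-]; rewrite ?ReD. Qed.

Lemma parseval Q (Y : nat -> H) :
  \sum_(k < Q) nrm (\sum_(j < Q) e2pii (k%:R / Q%:R) ^+ j *: Y j) ^+ 2 =
  Q%:R * \sum_(j < Q) nrm (Y j) ^+ 2.
Proof.
transitivity (\sum_(k < Q) \sum_(j < Q) \sum_(l < Q)
    complex.Re (e2pii (k%:R / Q%:R) ^+ j * Num.conj (e2pii (k%:R / Q%:R) ^+ l)
                * dot (Y j) (Y l))).
  apply: eq_bigr => k _; rewrite -(ip_nrm dot_norm) ip_suml.
  apply: eq_bigr => j _; rewrite ip_sumr; apply: eq_bigr => l _.
  by rewrite /ip dotZl dotZr mulrA.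
rewrite exchange_big mulr_sumr; apply: eq_bigr => j _.
rewrite exchange_big (bigD1 j)//= [X in _ + X]big1 ?addr0 => [|l lj].
  rewrite -Re_sum -mulr_suml sum_roots_of_unity// eqxx.
  by rewrite -(rmorph_nat (real_complex R)) ReM_real -(ip_nrm dot_norm).
by rewrite -Re_sum -mulr_suml sum_roots_of_unity// ifN ?mul0r// eq_sym.
Qed.

(** The coefficient of z^i in the product of the polynomials with coefficients c_a (a < K) and X_b
    (b < P). All indices a + b are below P + K, so nothing wraps around modulo P + K. *)
Definition convolution K P (c : nat -> R) (X : nat -> H) (i : nat) : H :=
  \sum_(a < K) \sum_(b < P | (a + b == i)%N) (c a)%:C *: X b.

(** The discrete Fourier transform turns the convolution into a product. The factor coming from [X]
    is at most [E] at every root of unity, and Parseval controls the mean square of the factor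
    coming from [c]. *)
Lemma convolution_bound K P (c : nat -> R) (X : nat -> H) E :
  (forall n, `|c n| <= 1) ->
  (forall k, (k < P + K)%N ->
     nrm (\sum_(b < P) e2pii (k%:R / (P + K)%:R) ^+ b *: X b) <= E) ->
  \sum_(i < P + K) nrm (convolution K P c X i) ^+ 2 <= K%:R * E ^+ 2.
Proof.
move=> c1 XE; set Q := (P + K)%N.
pose z (k : nat) : R[i] := e2pii (k%:R / Q%:R).
pose chat k := \sum_(a < K) z k ^+ a * (c a)%:C.
case: (posnP Q) => [Q0|Q_gt0].
  rewrite Q0 big_ord0 mulr_ge0//; exact: sqr_ge0.
have QR : 0 < Q%:R :> R by rewrite ltr0n.
have hat k : \sum_(i < Q) z k ^+ i *: convolution K P c X i =
    chat k *: \sum_(b < P) z k ^+ b *: X b.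
  under eq_bigr do rewrite scaler_sumr.
  rewrite exchange_big scaler_suml; apply: eq_bigr => a _.
  under eq_bigr do rewrite scaler_sumr big_mkcond.
  rewrite exchange_big scaler_sumr; apply: eq_bigr => b _.
  have abQ : (a + b < Q)%N by have := ltn_ord a; have := ltn_ord b; lia.
  rewrite (bigD1 (Ordinal abQ))//= eqxx big1 ?addr0 => [|i].
    by rewrite exprD !scalerA; congr (_ *: _); rewrite mulrAC.
  by rewrite -val_eqE /= eq_sym => /negPf->.
(* Parseval for the scalar sequence [c], read off along the vector [v]. *)
have chat_sum (v : H) : nrm v ^+ 2 * \sum_(k < Q) cabs (chat k) ^+ 2 <=
    nrm v ^+ 2 * (Q%:R * K%:R).
  have := parseval Q (fun j => (if (j < K)%N then c j else 0)%:C *: v).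
  have -> : \sum_(k < Q) nrm (\sum_(j < Q) e2pii (k%:R / Q%:R) ^+ j *:
      ((if (j < K)%N then c j else 0)%:C *: v)) ^+ 2 =
      nrm v ^+ 2 * \sum_(k < Q) cabs (chat k) ^+ 2.
    rewrite mulr_sumr; apply: eq_bigr => k _; rewrite -exprMn [nrm v * _]mulrC -nrmZ.
    congr (nrm _ ^+ 2); rewrite scaler_suml.
    rewrite -(big_mkord xpredT (fun j => z k ^+ j *:
      ((if (j < K)%N then c j else 0)%:C *: v))).
    rewrite (@big_cat_nat _ _ _ K)//= ?leq_addl// [X in _ + X]big_nat [X in _ + X]big1 ?addr0.
      rewrite big_mkord; apply: eq_bigr => a _.
      by rewrite ltn_ord scalerA.
    by move=> i /andP[Ki _]; rewrite ltnNge Ki scale0r scaler0.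
  move=> ->; rewrite mulrCA ler_pM2l//.
  rewrite -(big_mkord xpredT (fun j =>
      nrm ((if (j < K)%N then c j else 0)%:C *: v) ^+ 2)).
  rewrite (@big_cat_nat _ _ _ K)//= ?leq_addl// [X in _ + X]big_nat [X in _ + X]big1 ?addr0.
    rewrite [leRHS]mulrC mulr_natl -[X in _ *+ X]subn0 -sumr_const_nat.
    rewrite !big_mkord ler_sum// => a _.
    rewrite ltn_ord nrmZ_real exprMn ler_piMl ?sqr_ge0//.
    by rewrite expr_le1// normr_ge0.
  by move=> i /andP[Ki _]; rewrite ltnNge Ki scale0r nrm0 expr0n.
(* Dividing the scalar Parseval bound by the squared norm of [v] requires a nonzero vector; if all
   [X b] vanish, so does the convolution. *)
have [X0|[b Xb]] : (forall b, X b = 0) \/ exists b, X b != 0.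
- have [|/existsNP[b /eqP]] := pselect (forall b, X b = 0); first by left.
  by right; exists b.
- have KE : 0 <= K%:R * E ^+ 2 by rewrite mulr_ge0// sqr_ge0.
  rewrite big1// => i _.
  rewrite /convolution big1 ?nrm0 ?expr0n// => a _.
  by rewrite big1// => b _; rewrite X0 scaler0.
- have v0 : 0 < nrm (X b) ^+ 2.
    rewrite exprn_gt0// lt_neqAle nrm_ge0 andbT eq_sym.
    by apply/eqP => /nrm_eq0/eqP; rewrite (negPf Xb).
  have := chat_sum (X b); rewrite ler_pM2l// => csum.
  rewrite -(ler_pM2l QR) -(parseval Q (convolution K P c X)).
  under eq_bigr do rewrite -/(z _) hat nrmZ exprMn.
  have : \sum_(k < Q) cabs (chat k) ^+ 2 * nrm (\sum_(b < P) z k ^+ b *: X b) ^+ 2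
      <= \sum_(k < Q) cabs (chat k) ^+ 2 * E ^+ 2.
    apply: ler_sum => k _; apply: ler_wpM2l; first exact: sqr_ge0.
    have XkE := XE _ (ltn_ord k).
    by rewrite ler_pXn2r ?nnegrE ?nrm_ge0// (le_trans (nrm_ge0 _) XkE).
  move/le_trans; apply; rewrite -mulr_suml [leRHS]mulrA.
  by apply: ler_wpM2r; [exact: sqr_ge0|exact: csum].
Qed.

End Parseval.

(** * Bounded weights along the integer exponents *)

Section Good.
Variables (R : realType) (H : completeNormedModType R[i]).
Variable dot : {dot H for Num.conj}.
Hypothesis dot_norm : forall x : H, dot x x = `|x| ^+ 2.
Variables (T : {linear H -> H}) (M : R).
Hypothesis T_bound : forall n v, nrm (iter n T v) <= M * nrm v.
Hypothesis M1 : 1 <= M.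

Let M0 : 0 < M. Proof. exact: lt_le_trans M1. Qed.

Definition weighted_sum (a : nat -> nat) (c : nat -> R) (x : H) (N : nat) : H :=
  \sum_(n < N) (c n)%:C *: iter (a n) T x.

(** The threshold [n0] precedes the weights: later arguments regroup, split or multiply weights in
    ways that depend on N. *)
Definition good (a : nat -> nat) := forall x e, 0 < e ->
  exists n0, forall N, (n0 <= N)%N -> forall c, (forall n, `|c n| <= 1) ->
    nrm (weighted_sum a c x N) <= N%:R * e.

Lemma weighted_sumB a c x m n : (m <= n)%N ->
  weighted_sum a c x n - weighted_sum a c x m =
  \sum_(m <= i < n) (c i)%:C *: iter (a i) T x.
Proof.
move=> mn; rewrite /weighted_sum.
rewrite -!(big_mkord xpredT (fun i => (c i)%:C *: iter (a i) T x)).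
by rewrite (@big_cat_nat _ _ _ m 0 n)//= addrAC subrr add0r.
Qed.

Lemma nrm_weight (c : nat -> R) x n k : `|c n| <= 1 ->
  nrm ((c n)%:C *: iter k T x) <= M * nrm x.
Proof.
move=> c1; rewrite nrmZ_real; apply: le_trans (T_bound k x).
by rewrite ler_piMl// nrm_ge0.
Qed.

Lemma nrm_weighted_sum a c x N : (forall n, `|c n| <= 1) ->
  nrm (weighted_sum a c x N) <= N%:R * (M * nrm x).
Proof.
move=> c1; rewrite /weighted_sum -(big_mkord xpredT (fun n => (c n)%:C *: iter (a n) T x)).
by rewrite -{2}[N]subn0; apply: nrm_sum_const => i _; exact: nrm_weight.
Qed.

(** Windows are peeled off at the right end by strong induction until the remaining length is below
    n0. *)
Lemma nrm_window (S : nat -> H) n0 (B e : R) : 0 <= e ->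
  (forall n, (n < n0)%N -> nrm (S n) <= B) ->
  (forall N, (n0 <= N)%N -> exists K,
     [/\ (0 < K)%N, (K <= N)%N & nrm (S N - S (N - K)%N) <= K%:R * e]) ->
  0 <= B -> forall N, nrm (S N) <= N%:R * e + B.
Proof.
move=> e0 SB SW B0 N; elim/ltn_ind: N => N IH.
have [Nn0|n0N] := ltnP N n0.
  by rewrite (le_trans (SB _ Nn0))// lerDr mulr_ge0.
have [K [K0 KN SK]] := SW _ n0N.
have -> : S N = S (N - K)%N + (S N - S (N - K)%N) by rewrite addrC subrK.
have NK : (N - K < N)%N by rewrite ltn_subrL K0 (leq_trans K0).
rewrite (le_trans (nrmD _ _))//; have := IH _ NK; rewrite natrB//; lra.
Qed.

Lemma good_of_windows a :
  (forall x e, 0 < e -> exists n0, forall N, (n0 <= N)%N -> exists K,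
    [/\ (0 < K)%N, (K <= N)%N & forall c, (forall n, `|c n| <= 1) ->
      nrm (\sum_(N - K <= n < N) (c n)%:C *: iter (a n) T x) <= K%:R * e]) ->
  good a.
Proof.
move=> W x e e0; have e2 : 0 < e / 2 by rewrite divr_gt0.
have [n0 n0P] := W x _ e2.
have B0 : 0 <= n0%:R * (M * nrm x) by rewrite !mulr_ge0 ?nrm_ge0 ?(ltW M0).
exists (Num.truncn (n0%:R * (M * nrm x) / (e / 2))).+1 => N NB c c1.
have := @nrm_window (weighted_sum a c x) n0 _ _ (ltW e2) _ _ B0 N.
move=> /(_ _ _)/le_trans; apply.
- move=> n nn0; rewrite (le_trans (nrm_weighted_sum _ _ _ c1))//.
  by rewrite ler_wpM2r ?mulr_ge0 ?nrm_ge0 ?(ltW M0)// ler_nat ltnW.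
- move=> n /n0P[K [K0 Kn WK]]; exists K; split => //.
  by rewrite weighted_sumB ?leq_subr// WK.
- have : n0%:R * (M * nrm x) <= N%:R * (e / 2).
    rewrite -ler_pdivrMr// (le_trans (ltW (truncnS_gt _)))// ler_nat.
    exact: NB.
  by lra.
Qed.

Hypothesis T_eig : forall t v, T v = e2pii t *: v -> v = 0.

Lemma good_id : good id.
Proof.
apply: good_of_windows => x e e0.
pose e' := e / (2 * M).
have e'0 : 0 < e' by rewrite divr_gt0 ?mulr_gt0.
have [k0 k0P] := uniform_negligible dot_norm T_bound M1 T_eig x e'0.
exists (2 * k0.+1)%N => N Nk0; pose K := N./2.
have N2 : N = (odd N + K.*2)%N by rewrite odd_double_half.
have Kk0 : (k0 < K)%N by lia.
have KR : 0 < K%:R :> R by rewrite ltr0n; lia.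
exists K; split; [by lia|by lia|move=> c c1].
(* Reversing the weights turns the window sum into a convolution: the coefficient at K - 1 + j is
   T^j u for every j < K, while the window sum itself is T^(N-K) u. *)
pose c' n := c (N - n.+1)%N.
pose u := \sum_(n < K) (c' n)%:C *: iter (K - n.+1) T x.
have -> : \sum_(N - K <= n < N) (c n)%:C *: iter n T x = iter (N - K) T u.
  rewrite -{1}[(N - K)%N]add0n big_addn subKn; last by lia.
  rewrite big_mkord (reindex_inj rev_ord_inj)/= iter_sum.
  apply: eq_bigr => i _; rewrite iter_linZ -iterD /c'.
  have iK := ltn_ord i.
  by congr ((c _)%:C *: iter _ _ _); lia.
have E k : (k < K.*2 + K)%N ->
    nrm (\sum_(b < K.*2) e2pii (k%:R / (K.*2 + K)%:R) ^+ b *: iter b T x)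
    <= K.*2%:R * e'.
  move=> kQ; have := k0P K.*2 _ (k%:R / (K.*2 + K)%:R) _; rewrite /orbit_sum.
  under eq_bigr do rewrite iter_rotate.
  apply; first by lia.
  rewrite divr_ge0//= ler_pdivrMr; last by rewrite ltr0n; lia.
  by rewrite mul1r ler_nat ltnW.
have := @convolution_bound R H dot dot_norm K K.*2 c' (fun b => iter b T x) _
  (fun n => c1 _) E.
have conv j : (j < K)%N ->
    convolution K K.*2 c' (fun b => iter b T x) (K.-1 + j) = iter j T u.
  move=> jK; rewrite /convolution iter_sum; apply: eq_bigr => a _.
  have aK := ltn_ord a.
  have h : (K.-1 + j - a < K.*2)%N by lia.
  rewrite (big_pred1 (Ordinal h)) => [|b]; last first.
    by rewrite /= -val_eqE /=; apply/eqP/eqP; lia.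
  by rewrite /= iter_linZ -iterD; congr (_ *: iter _ _ _); lia.
have : \sum_(0 <= j < K) nrm (iter j T u) ^+ 2 <=
    \sum_(i < K.*2 + K) nrm (convolution K K.*2 c' (fun b => iter b T x) i) ^+ 2.
  rewrite -(big_mkord xpredT (fun i =>
     nrm (convolution K K.*2 c' (fun b => iter b T x) i) ^+ 2)).
  have k1 : (K.-1 <= K.-1 + K)%N by rewrite leq_addr.
  have k2 : (K.-1 + K <= K.*2 + K)%N by lia.
  rewrite (@big_cat_nat _ _ _ K.-1 0 (K.*2 + K))//=; last by lia.
  rewrite (@big_cat_nat _ _ _ (K.-1 + K) K.-1 (K.*2 + K))//=.
  rewrite -{2}[K.-1]add0n [X in _ + (X + _)]big_addn addKn.
  rewrite -[leLHS]add0r -[leLHS]addr0 -addrA lerD//.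
    by rewrite sumr_ge0// => i _; exact: sqr_ge0.
  rewrite lerD//; last by rewrite sumr_ge0// => i _; exact: sqr_ge0.
  rewrite big_nat [leRHS]big_nat ler_sum// => i /andP[_ iK].
  by rewrite addnC conv.
move=> /le_trans/[apply] h.
(* Since j < K <= N - K, power boundedness bounds T^(N-K) u by M times each T^j u, so the mean
   square over j dominates the single vector wanted. *)
have low : K%:R * (nrm (iter (N - K) T u) / M) ^+ 2 <=
    \sum_(0 <= j < K) nrm (iter j T u) ^+ 2.
  rewrite -{1}[K]subn0; apply: sum_nat_ge => i /andP[_ iK].
  rewrite ler_pXn2r ?nnegrE ?divr_ge0 ?nrm_ge0 ?(ltW M0)//.
  rewrite ler_pdivrMr// mulrC.
  rewrite (_ : iter (N - K) T u = iter (N - K - i) T (iter i T u)) ?T_bound//.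
  by rewrite -iterD subnK//; lia.
move: (le_trans low h); rewrite ler_pM2l// ler_pXn2r ?nnegrE//; last 2 first.
- by rewrite divr_ge0 ?nrm_ge0 ?(ltW M0).
- by rewrite mulr_ge0// ltW.
rewrite ler_pdivrMr// => /le_trans; apply.
rewrite -muln2 natrM /e' le_eqVlt; apply/orP; left; apply/eqP.
by field; rewrite gt_eqF.
Qed.

End Good.

Lemma natr_eventually (R : realType) (b : R) : exists n0, forall n, (n0 <= n)%N -> b <= n%:R.
Proof.
exists (Num.truncn b).+1 => n h.
by rewrite (le_trans (ltW (truncnS_gt _)))// ler_nat.
Qed.

Lemma sumr_shift_support (V : zmodType) (F : nat -> V) N1 N r i :
  (forall n, (n < N1)%N || (N <= n)%N -> F n = 0) -> (i <= r)%N -> (r <= N1)%N ->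
  (N1 <= N)%N ->
  \sum_(N1 - r <= b < N) F (b + i)%N = \sum_(N1 <= n < N) F n.
Proof.
move=> F0 ir rN1 N1N.
have -> : \sum_(N1 - r <= b < N) F (b + i)%N = \sum_(N1 - r + i <= n < N + i) F n.
  by rewrite big_addn addnK.
rewrite (@big_cat_nat _ _ _ N1)/=; [|lia|lia].
rewrite (@big_cat_nat _ _ _ N N1)/=; [|lia|lia].
rewrite big_nat big1 ?add0r => [|n /andP[_ h]]; last by rewrite F0// h.
rewrite [X in _ + X]big_nat [X in _ + X]big1 ?addr0// => n /andP[h _].
by rewrite F0// h orbT.
Qed.

Lemma sumr_sqr_le (R : realType) (F : nat -> R) m n :
  (\sum_(m <= i < n) F i) ^+ 2 <= (n - m)%:R * \sum_(m <= i < n) F i ^+ 2.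
Proof.
rewrite expr2 mulr_suml.
have : \sum_(m <= i < n) F i * \sum_(m <= j < n) F j <=
    \sum_(m <= i < n) \sum_(m <= j < n) (F i ^+ 2 / 2 + F j ^+ 2 / 2).
  apply: ler_sum => i _; rewrite mulr_sumr; apply: ler_sum => j _.
  by have := sqr_ge0 (F i - F j); lra.
move/le_trans; apply; under eq_bigr do rewrite big_split sumr_const_nat.
rewrite big_split/= sumr_const_nat -!mulr_suml sumrMnl -mulr_suml -mulr_natl.
by rewrite -[X in _ + X]mulr_natl; lra.
Qed.

(** * Perturbed exponents and functions of order one *)

Section Transfer.
Variables (R : realType) (H : completeNormedModType R[i]).
Variables (T : {linear H -> H}) (M : R).
Hypothesis T_bound : forall n v, nrm (iter n T v) <= M * nrm v.
Hypothesis M1 : 1 <= M.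

Let M0 : 0 < M. Proof. exact: lt_le_trans M1. Qed.

Let B_ge0 (x : H) : 0 <= M * nrm x.
Proof. by rewrite mulr_ge0 ?nrm_ge0 ?(ltW M0). Qed.

Lemma nrm_prefix (D : nat -> H) n0 b N : 0 <= b ->
  (forall n, nrm (D n) <= b) -> (forall n, (n0 <= n)%N -> D n = 0) ->
  nrm (\sum_(n < N) D n) <= n0%:R * b.
Proof.
move=> b0 Db D0; have [Nn0|/ltnW n0N] := leqP N n0.
  rewrite -(big_mkord xpredT D) (@le_trans _ _ (N%:R * b))//.
    by rewrite -{2}[N]subn0; apply: nrm_sum_const => i _.
  by rewrite ler_wpM2r// ler_nat.
rewrite -(big_mkord xpredT D) (@big_cat_nat _ _ _ n0)//=.
rewrite [X in _ + X]big_nat [X in _ + X]big1 ?addr0 => [|i /andP[h _]]; last exact: D0.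
by rewrite -{2}[n0]subn0; apply: nrm_sum_const => i _.
Qed.

(** The weights are split according to whether the exponent is [a n] or [a n + 1]; the second part
    is a weighted sum for the vector [T x]. The first n0 terms contribute a constant. *)
Lemma good_perturb (a b : nat -> nat) n0 :
  (forall n, (n0 <= n)%N -> b n = a n \/ b n = (a n).+1) ->
  good T a -> good T b.
Proof.
move=> ab Ga x e e0; have e3 : 0 < e / 3 by rewrite divr_gt0.
have [n1 H1] := Ga x _ e3; have [n2 H2] := Ga (T x) _ e3.
have [n3 H3] := natr_eventually (n0%:R * (M * nrm x + M * nrm x) / (e / 3)).
exists (maxn n1 (maxn n2 n3)) => N; rewrite !geq_max => /and3P[N1 N2 N3] c c1.
pose c_ n := if b n == a n then c n else 0.
pose c' n := if b n == a n then 0 else c n.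
have c_1 n : `|c_ n| <= 1 by rewrite /c_; case: ifP; rewrite ?normr0 ?ler01.
have c'1 n : `|c' n| <= 1 by rewrite /c'; case: ifP; rewrite ?normr0 ?ler01.
pose D n := (c n)%:C *: iter (b n) T x - ((c_ n)%:C *: iter (a n) T x +
  (c' n)%:C *: iter (a n) T (T x)).
have -> : weighted_sum T b c x N =
    weighted_sum T a c_ x N + weighted_sum T a c' (T x) N + \sum_(n < N) D n.
  rewrite /weighted_sum -!big_split/=; apply: eq_bigr => n _.
  by rewrite /D [RHS]addrC subrK.
have DE n : D n = if b n == a n then 0
    else (c n)%:C *: iter (b n) T x - (c n)%:C *: iter (a n).+1 T x.
  rewrite /D /c_ /c'; case: eqP => [->|_]; rewrite scale0r.
    by rewrite addr0 subrr.
  by rewrite add0r -iterSr.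
have hD : nrm (\sum_(n < N) D n) <= n0%:R * (M * nrm x + M * nrm x).
  apply: nrm_prefix => [|n|n /ab h]; first by rewrite addr_ge0.
    rewrite DE; case: ifP => _; first by rewrite nrm0 addr_ge0.
    by rewrite (le_trans (nrmBD _ _))// lerD// nrm_weight.
  by rewrite DE; case: eqP => //; case: h => // -> _; rewrite subrr.
have := H1 _ N1 _ c_1; have := H2 _ N2 _ c'1; have := H3 _ N3.
rewrite ler_pdivrMr//.
have := nrmD (weighted_sum T a c_ x N + weighted_sum T a c' (T x) N) (\sum_(n < N) D n).
have := nrmD (weighted_sum T a c_ x N) (weighted_sum T a c' (T x) N).
by lra.
Qed.

(** As [f] gains at least k per step, indices with the same integer part lie within distance 1 / k
    of the least one. *)
Lemma count_level_le (f : nat -> R) n0 N v k : 0 < k ->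
  (forall m n, (n0 <= m)%N -> (m <= n)%N -> (n < N)%N -> 0 <= f m /\
     (n - m)%:R * k <= f n - f m) ->
  (count (fun n => Num.truncn (f n) == v) (index_iota n0 N))%:R <= k^-1 + 1.
Proof.
move=> k0 fk; set P := fun n => _.
have [h|h] := boolP (has P (index_iota n0 N)); last first.
  by move: h; rewrite has_count -leqNgt leqn0 => /eqP->; rewrite addr_ge0 ?invr_ge0 ?(ltW k0).
have ex : exists n, (n0 <= n < N)%N && P n.
  by have /hasP[n] := h; rewrite mem_index_iota => h1 h2; exists n; rewrite h1.
have [p /andP[/andP[n0p pN] Pp] pmin] := ex_minnP ex.
pose q := (Num.truncn k^-1).+1.
have -> : count P (index_iota n0 N) = size (seq.filter P (index_iota n0 N)).
  by rewrite size_filter.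
have : (size (seq.filter P (index_iota n0 N)) <= size (index_iota p (p + q)))%N.
  apply: uniq_leq_size; first by rewrite filter_uniq// iota_uniq.
  move=> n; rewrite mem_filter !mem_index_iota => /andP[Pn /andP[n0n nN]].
  have pn : (p <= n)%N by apply: pmin; rewrite n0n nN.
  rewrite pn/=; have [fp h1] := fk _ _ n0p pn nN.
  have [fn _] := fk _ _ n0n (leqnn n) nN.
  have fp1 := truncn_itv fp; have fn1 := truncn_itv fn.
  move: fp1 fn1; rewrite (eqP Pp) (eqP Pn) => /andP[fp1 fp2] /andP[fn1 fn2].
  have : (n - p)%:R * k < 1 by move: fn2; rewrite -natr1; lra.
  rewrite -ltr_pdivlMr// mul1r => np.
  have : ((n - p)%:R : R) < q%:R by rewrite (lt_trans np)// truncnS_gt.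
  by rewrite ltr_nat -(ltn_add2l p) subnKC.
rewrite size_iota addKn => sq.
have : (size (seq.filter P (index_iota n0 N)))%:R <= q%:R :> R by rewrite ler_nat.
move/le_trans; apply; rewrite /q -natr1 lerD2r truncn_le.
by rewrite invr_ge0 ltW.
Qed.

Lemma good_discrete_P1 (f : nat -> R) : discrete_P 1 f -> good T id ->
  good T (fun n => Num.truncn (f n)).
Proof.
move=> fP Gid; have f_unb := discrete_P_unbounded fP.
case: fP => C [n0' fP'].
pose n0 := n0'.+1.
have fP n : (n0 <= n)%N -> [/\ 0 < f n, 0 < fdiff f n, f n <= C * n%:R * fdiff f n
    & forall s, (n <= s)%N -> fdiff f s <= C * fdiff f n].
  move=> /ltnW/fP'[p q1 q2]; split; [exact: (p 0%N)|exact: (p 1%N)|exact: q1|exact: q2].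
have mon : forall m n, (n0 <= m)%N -> (m <= n)%N -> f m <= f n.
  by apply: fdiff_nondecr => n /fP[_ /ltW].
have [f0 d0 _ dC] := fP _ (leqnn n0).
have C0 : 0 < C by have := dC _ (leqnn n0); nra.
(* [C1] is a linear growth bound for [f]. The sum regrouped by levels has at most 2 f(N) terms with
   weights bounded by W = C / ([fdiff f N]) + 1, and W f(N) <= (C^2 + C1) N; this gives [D]. *)
move=> x e e0; pose C1 := f n0 + C * fdiff f n0.
pose D := 2 * (C ^+ 2 + C1).
have C10 : 0 < C1 by rewrite addr_gt0 ?mulr_gt0.
have D0 : 0 < D by rewrite mulr_gt0// addr_gt0// exprn_gt0.
have eD : 0 < e / (2 * D) by rewrite divr_gt0// mulr_gt0.
have [v0 v0P] := Gid x _ eD.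
have [n1 n1P] := f_unb (Num.max 1 v0%:R).
have [n2 n2P] := natr_eventually (n0%:R * (M * nrm x) / (e / 2)).
exists (maxn n0.+1 (maxn n1 n2)) => N; rewrite !geq_max => /and3P[n0N /n1P + /n2P N2] c c1.
rewrite ge_max ler_pdivrMr ?divr_gt0// in N2 * => /andP[fN1 fNv].
pose a n := Num.truncn (f n); set V := (a N).+1.
have n0N' := ltnW n0N; have [fN dN fdN _] := fP _ n0N'.
pose k := fdiff f N / C; have k0 : 0 < k by rewrite divr_gt0.
pose W := k^-1 + 1; have W0 : 0 < W by rewrite addr_gt0 ?invr_gt0.
pose w v := \sum_(n0 <= n < N | a n == v) c n.
have wW v : `|w v / W| <= 1.
  rewrite normrM normfV (gtr0_norm W0) ler_pdivrMr// mul1r.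
  rewrite (le_trans (ler_norm_sum _ _ _))//.
  have : \sum_(n0 <= n < N | a n == v) `|c n| <= \sum_(n0 <= n < N | a n == v) 1.
    by apply: ler_sum.
  move/le_trans; apply.
  have -> : \sum_(n0 <= n < N | a n == v) 1 =
      (count (fun n => a n == v) (index_iota n0 N))%:R :> R.
    by rewrite -sum1_count natr_sum.
  apply: count_level_le => // m n n0m mn nN; split.
    by have [/ltW] := fP _ n0m.
  rewrite (sum_fdiff f mn) addrAC subrr add0r; apply: sum_nat_ge => i /andP[mi ni].
  have [_ _ _ h] := fP i (leq_trans n0m mi).
  by rewrite ler_pdivrMr// mulrC h// ltnW// (ltn_trans ni).
have -> : weighted_sum T a c x N = weighted_sum T a c x n0 +
    (W%:C *: weighted_sum T id (fun v => w v / W) x V).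
  rewrite -[LHS](subrK (weighted_sum T a c x n0)) addrC weighted_sumB//; congr (_ + _).
  rewrite /weighted_sum scaler_sumr.
  under [RHS]eq_bigr => v _.
    rewrite scalerA -rmorphM /= mulrC divfK ?gt_eqF// /w big_mkcond rmorph_sum scaler_suml.
    over.
  rewrite exchange_big/= big_nat [RHS]big_nat; apply: eq_bigr => n /andP[n0n nN].
  have anV : (a n < V)%N by rewrite ltnS le_truncn// mon// ltnW.
  rewrite (bigD1 (Ordinal anV))//= eqxx big1 ?addr0// => v.
  by rewrite -val_eqE /= eq_sym => /negPf->; rewrite scale0r.
rewrite (le_trans (nrmD _ _))//.
have h1 := nrm_weighted_sum T_bound a x n0 c1.
have V0 : (v0 <= V)%N.
  by rewrite leqW// /a truncn_ge_nat// ltW.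
have h2 := v0P _ V0 _ wW.
rewrite nrmZ_real gtr0_norm//.
have h3 : W * (V%:R * (e / (2 * D))) <= N%:R * (e / 2).
  have VF : V%:R <= 2 * f N.
    by rewrite /V -natr1; have := truncn_le (f N); rewrite (ltW fN); lra.
  have fC1 : f N <= C1 * N%:R.
    rewrite (sum_fdiff f n0N').
    have : \sum_(n0 <= i < N) fdiff f i <= \sum_(n0 <= i < N) (C * fdiff f n0).
      rewrite big_nat [leRHS]big_nat ler_sum// => i /andP[n0i _].
      exact: dC.
    rewrite sumr_const_nat -mulr_natl.
    have : (N - n0)%:R * (C * fdiff f n0) <= N%:R * (C * fdiff f n0).
      by apply: ler_wpM2r; [rewrite mulr_ge0// ltW|rewrite ler_nat leq_subr].
    have : f n0 <= f n0 * N%:R.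
      by rewrite ler_peMr ?(ltW f0)// ler1n (leq_trans _ n0N').
    by rewrite /C1; lra.
  have WF : W * f N <= (C ^+ 2 + C1) * N%:R.
    rewrite /W mulrDl mul1r mulrDl lerD//.
    rewrite /k invf_div mulrAC ler_pdivrMr// expr2.
    have : C * f N <= C * (C * N%:R * fdiff f N) by rewrite ler_pM2l.
    by lra.
  have : W * V%:R <= D * N%:R.
    have : W * V%:R <= W * (2 * f N) by rewrite ler_pM2l.
    by rewrite /D; lra.
  move=> WV; rewrite [leLHS]mulrA (@le_trans _ _ (D * N%:R * (e / (2 * D))))//.
    by rewrite ler_pM2r.
  by rewrite le_eqVlt; apply/orP; left; apply/eqP; field; rewrite gt_eqF.
have h4 : W * nrm (weighted_sum T id (fun v => w v / W) x V) <=
  W * (V%:R * (e / (2 * D))) by rewrite ler_pM2l.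
by lra.
Qed.

End Transfer.

(** * The van der Corput step *)

Section VanDerCorput.
Variables (R : realType) (H : completeNormedModType R[i]).
Variable dot : {dot H for Num.conj}.
Hypothesis dot_norm : forall x : H, dot x x = `|x| ^+ 2.
Variables (T : {linear H -> H}) (M : R).
Hypothesis T_bound : forall n v, nrm (iter n T v) <= M * nrm v.
Hypothesis M1 : 1 <= M.
Implicit Types (u v x : H).

Let M0 : 0 < M. Proof. exact: lt_le_trans M1. Qed.

Let B_ge0 x : 0 <= M * nrm x.
Proof. by rewrite mulr_ge0 ?nrm_ge0 ?(ltW M0). Qed.

(* Summing the inner product along the orbit gives a semi-inner product for
   which [T] is almost an isometry. *)
Definition orbit_ip L u v : R :=
  \sum_(0 <= j < L) ip dot (iter j T u) (iter j T v).

Lemma orbit_ipC L u v : orbit_ip L u v = orbit_ip L v u.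
Proof. by apply: eq_bigr => j _; rewrite ipC. Qed.

Lemma orbit_ip_suml L (I : Type) (s : seq I) (P : pred I) (F : I -> H) v :
  orbit_ip L (\sum_(i <- s | P i) F i) v = \sum_(i <- s | P i) orbit_ip L (F i) v.
Proof.
rewrite /orbit_ip exchange_big; apply: eq_bigr => j _.
by rewrite iter_sum ip_suml.
Qed.

Lemma orbit_ip_sumr L (I : Type) (s : seq I) (P : pred I) (F : I -> H) v :
  orbit_ip L v (\sum_(i <- s | P i) F i) = \sum_(i <- s | P i) orbit_ip L v (F i).
Proof. by rewrite orbit_ipC orbit_ip_suml; apply: eq_bigr => i _; rewrite orbit_ipC. Qed.

Lemma orbit_ipZl L (r : R) u v : orbit_ip L (r%:C *: u) v = r * orbit_ip L u v.
Proof.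
by rewrite /orbit_ip mulr_sumr; apply: eq_bigr => j _; rewrite iter_linZ ipZl.
Qed.

Lemma orbit_ipZr L (r : R) u v : orbit_ip L u (r%:C *: v) = r * orbit_ip L u v.
Proof. by rewrite orbit_ipC orbit_ipZl orbit_ipC. Qed.

Lemma orbit_ip_nrm L u : orbit_ip L u u = \sum_(0 <= j < L) nrm (iter j T u) ^+ 2.
Proof. by apply: eq_bigr => j _; rewrite (ip_nrm dot_norm). Qed.

Lemma ip_iter_le u v j k : `|ip dot (iter j T u) (iter k T v)| <= M * nrm u * (M * nrm v).
Proof.
rewrite (le_trans (ip_abs dot_norm _ _))//.
by rewrite ler_pM ?nrm_ge0.
Qed.

Lemma orbit_ip_le L u v : `|orbit_ip L u v| <= L%:R * (M * nrm u * (M * nrm v)).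
Proof.
rewrite (le_trans (ler_norm_sum _ _ _))//.
rewrite (le_trans (ler_sum _ (G := fun=> M * nrm u * (M * nrm v)) _))//.
  by move=> j _; exact: ip_iter_le.
by rewrite sumr_const_nat subn0 mulr_natl.
Qed.

(** Each application of [T] to both arguments shifts the summation range by one and changes only the
    two end terms, so the error depends on p but not on L. *)
Lemma orbit_ip_shift L p u v :
  `|orbit_ip L (iter p T u) (iter p T v) - orbit_ip L u v| <=
  p%:R * (2 * (M * nrm u * (M * nrm v))).
Proof.
pose g j := ip dot (iter j T u) (iter j T v).
have gE q : orbit_ip L (iter q T u) (iter q T v) = \sum_(0 <= j < L) g (j + q)%N.
  by apply: eq_bigr => j _; rewrite -!iterD.
elim: p => [|p IH]; first by rewrite subrr normr0 mul0r.
have -> : orbit_ip L (iter p.+1 T u) (iter p.+1 T v) - orbit_ip L u v =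
    (orbit_ip L (iter p T u) (iter p T v) - orbit_ip L u v) + (g (L + p)%N - g p).
  have : \sum_(0 <= j < L) (g (j.+1 + p)%N - g (j + p)%N) = g (L + p)%N - g p.
    by rewrite (telescope_sumr (fun j => g (j + p)%N)).
  rewrite sumrB -gE => <-; under eq_bigr do rewrite addSnnS.
  by rewrite -gE; ring.
rewrite (le_trans (ler_normD _ _))// -natr1 mulrDl mul1r lerD//.
rewrite (le_trans (ler_normB _ _))// mulr_natl mulr2n lerD//; exact: ip_iter_le.
Qed.

(** This returns from the semi-inner product to the norm: T^L u is bounded by M times each earlier
    T^j u. *)
Lemma nrm_iter_le_orbit_ip L u :
  L%:R * nrm (iter L T u) ^+ 2 <= M ^+ 2 * orbit_ip L u u.
Proof.
rewrite orbit_ip_nrm mulr_sumr -{1}[L]subn0; apply: sum_nat_ge => j /andP[_ jL].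
rewrite -exprMn ler_pXn2r ?nnegrE ?nrm_ge0//.
by rewrite -{1}(subnK (ltnW jL)) iterD T_bound.
Qed.

Lemma orbit_ip_sum_le L (v : nat -> H) m n :
  orbit_ip L (\sum_(m <= i < n) v i) (\sum_(m <= i < n) v i) <=
  (n - m)%:R * \sum_(m <= i < n) orbit_ip L (v i) (v i).
Proof.
rewrite orbit_ip_nrm.
under [X in _ <= _ * X]eq_bigr do rewrite orbit_ip_nrm.
rewrite exchange_big mulr_sumr; apply: ler_sum => j _.
apply: le_trans (sumr_sqr_le _ _ _).
rewrite ler_pXn2r ?nnegrE ?nrm_ge0 ?sumr_ge0//.
  by rewrite iter_sum nrm_sum.
by move=> i _; exact: nrm_ge0.
Qed.

(** The total sum is counted r times as a sum of blocks of length r, to which Cauchy-Schwarz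
    applies. Expanding the blocks gives r diagonal sums bounded through [G] and at most r^2
    correlations bounded by [E]. The condition r <= N1 keeps the starting index N1 - r from being
    truncated. *)
Lemma van_der_corput L (u : nat -> H) N1 N r G E :
  (forall n, (n < N1)%N || (N <= n)%N -> u n = 0) ->
  (r <= N1)%N -> (N1 <= N)%N -> 0 <= E ->
  (forall n, orbit_ip L (u n) (u n) <= G) ->
  (forall d, (0 < d)%N -> (d < r)%N ->
     `|\sum_(N1 <= n < N) orbit_ip L (u n) (u (n + d)%N)| <= E) ->
  r%:R ^+ 2 * orbit_ip L (\sum_(N1 <= n < N) u n) (\sum_(N1 <= n < N) u n) <=
    (N - N1 + r)%:R * (r%:R * ((N - N1)%:R * G) + r%:R ^+ 2 * E).
Proof.
move=> u0 rN1 N1N E0 uG uE; set U := \sum_(N1 <= n < N) u n.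
pose s b := \sum_(i < r) u (b + i)%N.
have sU : \sum_(N1 - r <= b < N) s b = r%:R%:C *: U.
  rewrite exchange_big rmorph_nat scaler_nat.
  rewrite -[X in _ *+ X]card_ord -sumr_const; apply: eq_bigr => i _.
  by apply: sumr_shift_support => //; exact: ltnW.
have -> : r%:R ^+ 2 * orbit_ip L U U =
    orbit_ip L (\sum_(N1 - r <= b < N) s b) (\sum_(N1 - r <= b < N) s b).
  by rewrite sU orbit_ipZl orbit_ipZr mulrA expr2.
rewrite (le_trans (orbit_ip_sum_le _ _ _ _))//.
have -> : (N - (N1 - r))%N = (N - N1 + r)%N by lia.
rewrite ler_wpM2l//.
have pair_sum (i j : 'I_r) : (i < j)%N ->
    \sum_(N1 - r <= b < N) orbit_ip L (u (b + i)%N) (u (b + j)%N) <= E.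
  move=> ij; have ijr : (j - i < r)%N by have := ltn_ord j; lia.
  have ij0 : (0 < j - i)%N by rewrite subn_gt0.
  apply: le_trans (le_trans (ler_norm _) (uE _ ij0 ijr)).
  rewrite -(@sumr_shift_support _ (fun n => orbit_ip L (u n) (u (n + (j - i))%N)) N1 N r i)//.
  - rewrite le_eqVlt; apply/orP; left; apply/eqP.
    apply: eq_bigr => b _; congr (orbit_ip L _ (u _)).
    by rewrite -addnA subnKC// ltnW.
  - move=> n /u0 ->; rewrite -(scale0r (0 : H)) -(rmorph0 (real_complex R)).
    by rewrite orbit_ipZl mul0r.
  - exact: ltnW.
have -> : \sum_(N1 - r <= b < N) orbit_ip L (s b) (s b) =
    \sum_(i < r) \sum_(j < r) \sum_(N1 - r <= b < N)
      orbit_ip L (u (b + i)%N) (u (b + j)%N).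
  under eq_bigr do rewrite orbit_ip_suml.
  rewrite exchange_big; apply: eq_bigr => i _.
  by under eq_bigr do rewrite orbit_ip_sumr; rewrite exchange_big.
have diag (i : 'I_r) : \sum_(N1 - r <= b < N) orbit_ip L (u (b + i)%N) (u (b + i)%N)
    <= (N - N1)%:R * G.
  rewrite (@sumr_shift_support _ (fun n => orbit_ip L (u n) (u n)) N1 N r i)//.
  - by rewrite mulr_natl -sumr_const_nat ler_sum.
  - move=> n /u0 ->; rewrite -(scale0r (0 : H)) -(rmorph0 (real_complex R)).
    by rewrite orbit_ipZl mul0r.
  - exact: ltnW.
apply: (@le_trans _ _ (\sum_(i < r) ((N - N1)%:R * G + \sum_(j < r | j != i) E))).
  apply: ler_sum => i _; rewrite (bigD1 i)//= lerD// ler_sum// => j ji.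
  have [ij|ij|/val_inj ij] := ltngtP i j; first exact: pair_sum.
    by under eq_bigr do rewrite orbit_ipC; exact: pair_sum.
  by rewrite ij eqxx in ji.
rewrite big_split/= lerD//; first by rewrite sumr_const card_ord [leRHS]mulr_natl.
have -> : r%:R ^+ 2 * E = \sum_(i < r) \sum_(j < r) E.
  by rewrite !sumr_const card_ord expr2 -mulrA !mulr_natl.
apply: ler_sum => i _; rewrite [leRHS](bigD1 i)//= lerDr.
exact: E0.
Qed.


(** With T^L factored out for L = a(N1), the van der Corput inequality leaves three terms: the
    diagonal, the failure of [T] to be an isometry over a(N) - a(N1) steps relative to L, and the
    correlations along the differences. *)
Lemma window_estimate (a : nat -> nat) (c : nat -> R) x N1 N r eta :
  (forall m n, (N1 <= m)%N -> (m <= n)%N -> (a m <= a n)%N) ->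
  (0 < r)%N -> (r <= N1)%N -> (r <= N - N1)%N -> (0 < a N1)%N -> 0 <= eta ->
  (forall n, `|c n| <= 1) ->
  (forall d, (0 < d)%N -> (d < r)%N -> forall c', (forall n, `|c' n| <= 1) ->
     nrm (weighted_sum T (fun n => (a (n + d) - a n)%N) c' x N) <= N%:R * eta) ->
  nrm (\sum_(N1 <= n < N) (c n)%:C *: iter (a n) T x) ^+ 2 <=
  2 * M ^+ 2 * (N - N1)%:R ^+ 2 *
    ((M * nrm x) ^+ 2 / r%:R
     + 2 * M * (M * nrm x) ^+ 2 * (a N - a N1)%:R / (a N1)%:R
     + M * (M * nrm x) * eta * (N%:R / (N - N1)%:R)).
Proof.
move=> amono r0 rN1 rK L0 eta0 c1 diff.
set L := a N1; set p := (a N - L)%N; set K := (N - N1)%N; set B := M * nrm x.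
have K0 : (0 < K)%N by rewrite (leq_trans r0).
have N1N : (N1 <= N)%N by rewrite ltnW// -subn_gt0.
have B0 : 0 <= B by exact: B_ge0.
pose u n := if (N1 <= n < N)%N then (c n)%:C *: iter (a n - L) T x else 0.
have u0 n : (n < N1)%N || (N <= n)%N -> u n = 0.
  by rewrite /u; case: ifP => // /andP[h1 h2]; rewrite ltnNge h1 leqNgt h2.
have -> : \sum_(N1 <= n < N) (c n)%:C *: iter (a n) T x =
    iter L T (\sum_(N1 <= n < N) u n).
  rewrite iter_sum big_nat [RHS]big_nat; apply: eq_bigr => n nN.
  rewrite /u nN iter_linZ -iterD subnKC//; apply: amono => //.
  by have /andP[] := nN.
have uG n : orbit_ip L (u n) (u n) <= L%:R * B ^+ 2.
  rewrite orbit_ip_nrm mulr_natl -{2}[L]subn0 -sumr_const_nat ler_sum// => j _.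
  rewrite ler_pXn2r ?nnegrE ?nrm_ge0// /u; case: ifP => _.
    by rewrite iter_linZ -iterD; exact: nrm_weight.
  by rewrite iter0v nrm0.
pose E := K%:R * (p%:R * (2 * (B * (M * B)))) + L%:R * (M * B * (N%:R * eta)).
have E0 : 0 <= E by have M_ge0 := ltW M0; rewrite addr_ge0// !mulr_ge0// ?nrm_ge0.
have uE d : (0 < d)%N -> (d < r)%N ->
    `|\sum_(N1 <= n < N) orbit_ip L (u n) (u (n + d)%N)| <= E.
  (* The cutoff keeps n and n + d in the window, so the correlation is a full weighted sum up to N
     with weights still bounded by 1. *)
  move=> d0 dr; pose c' n := if (N1 <= n)%N && (n + d < N)%N then c n * c (n + d)%N else 0.
  have c'1 n : `|c' n| <= 1.
    rewrite /c'; case: ifP => _; rewrite ?normr0 ?ler01//.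
    by rewrite normrM mulr_ile1.
  pose w n := iter (a (n + d) - a n)%N T x.
  pose q n := orbit_ip L (iter (a n - L) T x) (iter (a n - L) T (w n)) - orbit_ip L x (w n).
  have uu n : (N1 <= n < N)%N ->
      orbit_ip L (u n) (u (n + d)%N) = c' n * q n + c' n * orbit_ip L x (w n).
    move=> /andP[N1n nN]; rewrite -mulrDr /q subrK /u /c' N1n nN/=.
    rewrite (leq_trans N1n (leq_addr d n))/=; case: ifP => ndN; last first.
      by rewrite mul0r orbit_ipC -(scale0r x) -(rmorph0 (real_complex R)) orbit_ipZl mul0r.
    rewrite orbit_ipZl orbit_ipZr mulrA; congr (_ * orbit_ip L _ _).
    rewrite /w -iterD; congr (iter _ _ _).
    have := amono _ _ (leqnn N1) N1n; have := amono n (n + d)%N N1n (leq_addr _ _).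
    by rewrite -/L; move: (a (n + d)%N) (a n) => k l; clear; lia.
  rewrite big_nat (eq_bigr _ uu) -big_nat big_split/= (le_trans (ler_normD _ _))// lerD//.
    rewrite (le_trans (ler_norm_sum _ _ _))// mulr_natl -sumr_const_nat.
    rewrite big_nat [leRHS]big_nat ler_sum// => n /andP[N1n nN].
    rewrite normrM (@le_trans _ _ `|q n|)//.
      by rewrite ler_piMl.
    rewrite (le_trans (orbit_ip_shift _ _ _ _))// ler_pM ?mulr_ge0 ?nrm_ge0 ?(ltW M0)//.
      by rewrite ler_nat leq_sub2r// amono// ltnW.
    rewrite ler_pM2l// ler_wpM2l// ler_pM2l//; exact: T_bound.
  have -> : \sum_(N1 <= n < N) c' n * orbit_ip L x (w n) =
      orbit_ip L x (weighted_sum T (fun n => (a (n + d) - a n)%N) c' x N).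
    rewrite orbit_ip_sumr -(big_mkord xpredT (fun n =>
      orbit_ip L x ((c' n)%:C *: iter (a (n + d) - a n)%N T x))).
    rewrite (@big_cat_nat _ _ _ N1 0 N)//= [X in X + _]big_nat [X in X + _]big1 ?add0r.
      by apply: eq_bigr => n _; rewrite orbit_ipZr.
    by move=> n /andP[_ nN1]; rewrite orbit_ipZr /c' leqNgt nN1 mul0r.
  rewrite (le_trans (orbit_ip_le _ _ _))// ler_wpM2l// -/B [leRHS]mulrAC mulrC.
  rewrite ler_wpM2r// ler_pM2l//; exact: diff.
have vdc := van_der_corput u0 rN1 N1N E0 uG uE.
have low := nrm_iter_le_orbit_ip L (\sum_(N1 <= n < N) u n).
move: vdc low; rewrite -/K.
set X := orbit_ip L _ _; set Y := nrm _ ^+ 2 => vdc low.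
have rR : 0 < r%:R :> R by rewrite ltr0n.
have LR : 0 < L%:R :> R by rewrite ltr0n.
have KR : 0 < K%:R :> R by rewrite ltr0n.
have M20 : 0 < M ^+ 2 by rewrite exprn_gt0.
have F0 : 0 <= r%:R * (K%:R * (L%:R * B ^+ 2)) + r%:R ^+ 2 * E.
  have B20 := sqr_ge0 B; have r20 := sqr_ge0 (r%:R : R).
  clearbody E; apply: addr_ge0; last exact: mulr_ge0.
  by apply: mulr_ge0 => //; apply: mulr_ge0 => //; exact: mulr_ge0.
have vdc2 : r%:R ^+ 2 * X <= 2 * K%:R * (r%:R * (K%:R * (L%:R * B ^+ 2)) + r%:R ^+ 2 * E).
  apply: le_trans vdc _; rewrite ler_wpM2r// natrD.
  have : r%:R <= K%:R :> R by rewrite ler_nat.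
  by lra.
have r2L : 0 < r%:R ^+ 2 * L%:R :> R by rewrite mulr_gt0// exprn_gt0.
rewrite -(ler_pM2l r2L).
have h1 : r%:R ^+ 2 * (L%:R * Y) <= r%:R ^+ 2 * (M ^+ 2 * X) by rewrite ler_pM2l ?exprn_gt0.
have h2 : M ^+ 2 * (r%:R ^+ 2 * X) <= M ^+ 2 *
  (2 * K%:R * (r%:R * (K%:R * (L%:R * B ^+ 2)) + r%:R ^+ 2 * E)) by rewrite ler_pM2l.
rewrite -[leLHS]mulrA (le_trans h1)// [leLHS]mulrCA (le_trans h2)// le_eqVlt; apply/orP; left.
apply/eqP; rewrite /E; clear -rR LR KR; set l := L%:R; set k := K%:R.
by field; rewrite !gt_eqF.
Qed.

Lemma window_arith q r m0 N : (1 < q)%N -> (0 < r)%N -> (2 * r * q <= N)%N ->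
  (2 * m0 <= N)%N ->
  [/\ (r <= N %/ q)%N, (r <= N - N %/ q)%N, (m0 <= N - N %/ q)%N
    & (N - (N - N %/ q) = N %/ q)%N]
  /\ ((N %/ q) * q <= 2 * (N - N %/ q))%N /\ (N <= 2 * q * (N %/ q))%N.
Proof.
move=> q1 r0 Nrq Nm0; have q0 : (0 < q)%N by exact: ltnW.
have h1 : (2 * r <= N %/ q)%N by rewrite leq_divRL.
have h2 : (N %/ q * q <= N)%N by exact: leq_divM.
have h3 := ltn_ceil N q0; rewrite mulSn in h3.
move: (N %/ q)%N h1 h2 h3 => K h1 h2 h3.
have h4 : (2 * K <= K * q)%N by rewrite mulnC leq_mul2l q1 orbT.
have h5 : (q <= K * q)%N by rewrite leq_pmull//; lia.
have h6 : (2 * q * K = K * q + K * q)%N by lia.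
by split; [split; lia|split; lia].
Qed.

(** Each of the three terms of [window_estimate], times M^2, is made at most e^2 / 6. First q makes
    [f] nearly constant on the window, then r treats the diagonal, and finally [eta] treats the
    correlations, where N / K <= 2 q enters. *)
Lemma good_van_der_corput (f : nat -> R) : slow f ->
  (forall b, exists n0, forall n, (n0 <= n)%N -> b <= f n) ->
  (forall d, (0 < d)%N ->
     good T (fun n => (Num.truncn (f (n + d)%N) - Num.truncn (f n))%N)) ->
  good T (fun n => Num.truncn (f n)).
Proof.
move=> [C' [m0 fS]] f_unb diff; apply: (good_of_windows T_bound M1) => x e e0.
pose a n := Num.truncn (f n).
pose B := M * nrm x; have B0 : 0 <= B by exact: B_ge0.
pose C := `|C'| + 1; have C0 : 0 < C by rewrite ltr_wpDl.
have M30 : 0 < M ^+ 3 by rewrite exprn_gt0.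
have e20 : 0 < e ^+ 2 by rewrite exprn_gt0.
(* The first bound gives [rho <= 1/4]; the second makes the isometry defect 16 M^3 B^2 C / q at most
   e^2 / 6. *)
have [q0 q0P] := natr_eventually (Num.max (8 * C) (96 * M ^+ 3 * B ^+ 2 * C / e ^+ 2)).
pose q := maxn 2 q0; have q2 : (2 <= q)%N by rewrite leq_maxl.
have q_gt0 : (0 < q)%N by exact: ltnW.
have qR : 0 < q%:R :> R by rewrite ltr0n.
have : Num.max (8 * C) (96 * M ^+ 3 * B ^+ 2 * C / e ^+ 2) <= q%:R.
  by apply: q0P; rewrite leq_maxr.
rewrite ge_max => /andP[qC qe].
have [r0 r0P] := natr_eventually (6 * M ^+ 2 * B ^+ 2 / e ^+ 2).
pose r := r0.+1; have rR : 0 < r%:R :> R by rewrite ltr0n.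
have re : 6 * M ^+ 2 * B ^+ 2 / e ^+ 2 <= r%:R by apply: r0P; rewrite leqnSn.
pose eta := e ^+ 2 / (12 * M ^+ 3 * (B + 1) * q%:R).
have B1 : 0 < B + 1 by rewrite ltr_wpDl.
have eta0 : 0 < eta by rewrite divr_gt0// !mulr_gt0.
have [n1 n1P] : exists n1, forall N, (n1 <= N)%N ->
    forall d, (0 < d)%N -> (d < r)%N -> forall c', (forall n, `|c' n| <= 1) ->
    nrm (weighted_sum T (fun n => (a (n + d) - a n)%N) c' x N) <= N%:R * eta.
  elim: (r) => [|s [n1 IH]]; first by exists 0%N.
  have [s0|s0] := posnP s.
    by exists 0%N => N _ d d0; rewrite s0 ltnS leqNgt d0.
  have [n2 n2P] := diff s s0 x _ eta0.
  exists (maxn n1 n2) => N; rewrite geq_max => /andP[N1 N2] d d0.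
  rewrite ltnS leq_eqVlt => /orP[/eqP->|ds]; first exact: n2P.
  exact: IH.
(* Both bounds absorb rounding: f(N) >= 4 leaves a(N1) at least f(N) / 2, and f(N) >= q / (2 C)
   means [1 <= rho * f N], so a(N) - a(N1) is at most twice [rho * f N]. *)
have [n2 n2P] := f_unb (Num.max 4 (q%:R / (2 * C))).
exists (maxn (2 * r * q) (maxn (2 * m0) (maxn n1 n2))) => N.
rewrite !geq_max => /and4P[Nrq Nm0 /n1P diffN /n2P].
rewrite ge_max => /andP[f4 fq].
pose K := (N %/ q)%N; pose N1 := (N - K)%N.
have r_gt0 : (0 < r)%N by [].
have [[rK rN1 N1m0 KN1] [KqN1 NqK]] := window_arith q2 r_gt0 Nrq Nm0.
rewrite -/K -/N1 in rK rN1 N1m0 KN1 KqN1 NqK.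
have N1R : 0 < N1%:R :> R by rewrite ltr0n (leq_trans r_gt0).
have K_gt0 : (0 < K)%N by exact: leq_trans rK.
have KR : 0 < K%:R :> R by rewrite ltr0n.
have fS' n : (m0 <= n)%N -> [/\ 0 < f n, 0 <= fdiff f n & n%:R * fdiff f n <= C * f n].
  move=> /fS[h1 h2 h3]; split => //; rewrite (le_trans h3)// ler_pM2r//.
  by rewrite /C; have := ler_norm C'; lra.
have mon : forall m n, (m0 <= m)%N -> (m <= n)%N -> f m <= f n.
  by apply: fdiff_nondecr => n /fS'[].
have N1N : (N1 <= N)%N by exact: leq_subr.
have fN0 : 0 < f N by lra.
pose rho := 2 * C / q%:R.
have fNN1 : f N - f N1 <= rho * f N.
  rewrite (sum_fdiff f N1N) addrAC subrr add0r -(sum_fdiff f N1N).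
  have : \sum_(N1 <= n < N) fdiff f n <= \sum_(N1 <= n < N) (C * f N / N1%:R).
    rewrite big_nat [leRHS]big_nat ler_sum// => n /andP[N1n nN].
    have [_ d0 h] := fS' _ (leq_trans N1m0 N1n).
    rewrite ler_pdivlMr//.
    have : C * f n <= C * f N by rewrite ler_pM2l// mon ?(ltnW nN)// (leq_trans N1m0).
    have : fdiff f n * N1%:R <= fdiff f n * n%:R by rewrite ler_wpM2l// ler_nat.
    by lra.
  move/le_trans; apply; rewrite sumr_const_nat KN1 -[leLHS]mulr_natr.
  have KN1q : K%:R / N1%:R <= 2 / q%:R :> R.
    by rewrite ler_pdivrMr// mulrAC ler_pdivlMr// -!natrM ler_nat.
  have : C * f N * (K%:R / N1%:R) <= C * f N * (2 / q%:R) by rewrite ler_pM2l// mulr_gt0.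
  by rewrite /rho; lra.
have rho4 : rho <= 4^-1 by rewrite /rho ler_pdivrMr//; lra.
have rhof : 1 <= rho * f N.
  move: fq; rewrite ler_pdivrMr ?mulr_gt0// => fq.
  by rewrite /rho mulrAC ler_pdivlMr//; lra.
have rho_f : rho * f N <= 4^-1 * f N by rewrite ler_pM2r.
have fN1 : 0 < f N1 by have [] := fS' _ N1m0.
have aN1 : f N1 - 1 <= (a N1)%:R.
  by have := truncnS_gt (f N1); rewrite -natr1 -/(a N1); lra.
have aN : (a N)%:R <= f N by rewrite truncn_le ltW.
have aR : 2^-1 * f N <= (a N1)%:R by lra.
have a_gt0 : 0 < (a N1)%:R :> R by lra.
have amono m n : (N1 <= m)%N -> (m <= n)%N -> (a m <= a n)%N.
  by move=> N1m mn; rewrite le_truncn// mon// (leq_trans N1m0).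
have aa : (a N - a N1)%:R / (a N1)%:R <= 4 * rho.
  rewrite natrB ?amono// ler_pdivrMr//.
  have rho0 : 0 <= rho by rewrite divr_ge0 ?mulr_ge0 ?ltW.
  have : 4 * rho * (2^-1 * f N) <= 4 * rho * (a N1)%:R by rewrite ler_wpM2l// mulr_ge0.
  by lra.
have NK : N%:R / K%:R <= 2 * q%:R :> R.
  by rewrite ler_pdivrMr// -!natrM ler_nat.
exists K; split => [//||c c1]; first by rewrite -KN1 leq_subr.
rewrite -/N1.
rewrite -(@ler_pXn2r _ 2) ?nnegrE ?nrm_ge0 ?mulr_ge0 ?(ltW e0)//.
have := @window_estimate a c x N1 N r eta amono r_gt0 _ _ _ (ltW eta0) c1 diffN.
rewrite KN1 => /(_ _ _ _)/le_trans; apply => //; first by rewrite -(ltr0n R).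
rewrite [leRHS]exprMn -/B.
have t1 : M ^+ 2 * (B ^+ 2 / r%:R) <= e ^+ 2 / 6.
  by rewrite mulrA ler_pdivrMr//; move: re; rewrite ler_pdivrMr//; lra.
have t2 : M ^+ 2 * (2 * M * B ^+ 2 * (a N - a N1)%:R / (a N1)%:R) <= e ^+ 2 / 6.
  have MB0 : 0 <= M ^+ 3 * B ^+ 2 by rewrite mulr_ge0 ?sqr_ge0 ?(ltW M30).
  have : M ^+ 3 * B ^+ 2 * ((a N - a N1)%:R / (a N1)%:R) <= M ^+ 3 * B ^+ 2 * (4 * rho).
    by rewrite ler_wpM2l.
  have : M ^+ 3 * B ^+ 2 * (4 * rho) <= e ^+ 2 / 12.
    have -> : M ^+ 3 * B ^+ 2 * (4 * rho) = 8 * M ^+ 3 * B ^+ 2 * C / q%:R.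
      by rewrite /rho; ring.
    rewrite ler_pdivrMr//; move: qe; rewrite ler_pdivrMr//; lra.
  have -> : M ^+ 2 * (2 * M * B ^+ 2 * (a N - a N1)%:R / (a N1)%:R) =
    2 * (M ^+ 3 * B ^+ 2 * ((a N - a N1)%:R / (a N1)%:R)) by field; rewrite gt_eqF.
  by lra.
have t3 : M ^+ 2 * (M * B * eta * (N%:R / K%:R)) <= e ^+ 2 / 6.
  have MBe : 0 <= M ^+ 3 * B * eta.
    exact: mulr_ge0 (mulr_ge0 (ltW M30) B0) (ltW eta0).
  have : M ^+ 3 * B * eta * (N%:R / K%:R) <= M ^+ 3 * B * eta * (2 * q%:R).
    by rewrite ler_wpM2l.
  have : M ^+ 3 * B * eta * (2 * q%:R) <= e ^+ 2 / 6.
    have -> : e ^+ 2 / 6 = M ^+ 3 * (B + 1) * eta * (2 * q%:R).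
      by rewrite /eta; field; rewrite !gt_eqF.
    have : 0 <= M ^+ 3 * eta * (2 * q%:R).
      exact: mulr_ge0 (mulr_ge0 (ltW M30) (ltW eta0)) (mulr_ge0 (ler0n R 2) (ltW qR)).
    by lra.
  have -> : M ^+ 2 * (M * B * eta * (N%:R / K%:R)) = M ^+ 3 * B * eta * (N%:R / K%:R).
    by field; rewrite gt_eqF.
  by lra.
move: t1 t2 t3; set s1 := B ^+ 2 / _; set s2 := 2 * M * _ * _ / _; set s3 := M * B * _ * _.
move: s1 s2 s3 => s1 s2 s3 t1 t2 t3.
have K20 : 0 < K%:R ^+ 2 :> R by rewrite exprn_gt0.
have : K%:R ^+ 2 * (M ^+ 2 * (s1 + s2 + s3)) <= K%:R ^+ 2 * (e ^+ 2 / 2).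
  by rewrite ler_pM2l//; lra.
by lra.
Qed.

(** Induction on the order. The difference of the integer parts of f(n + d) and f(n) is the integer
    part of f(n + d) - f(n) or one more, so [good_perturb] links the correlations to the induction
    hypothesis. *)
Lemma good_discrete_P m (f : nat -> R) : discrete_P m.+1 f -> good T id ->
  good T (fun n => Num.truncn (f n)).
Proof.
move=> + Gid; elim: m f => [|m IH] f fP; first exact: (good_discrete_P1 T_bound fP Gid).
apply: good_van_der_corput; first exact: discrete_P_slow fP.
  exact: discrete_P_unbounded fP.
move=> d d0; have {}IH := IH _ (discrete_P_increment d0 fP).
case: fP => C [n0 fP].
have f_pos n : (n0 <= n)%N -> 0 < f n by move=> /fP[p _ _]; exact: (p 0%N).
have f_mono : forall m n, (n0 <= m)%N -> (m <= n)%N -> f m <= f n.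
  by apply: fdiff_nondecr => n /fP[p _ _]; exact/ltW/(p 1%N).
apply: (@good_perturb _ _ _ _ T_bound M1 _ _ n0 _ IH) => n n0n.
have nd := f_mono _ _ n0n (leq_addr d n).
have D0 : 0 <= f (n + d)%N - f n by rewrite subr_ge0.
have f0 := ltW (f_pos _ n0n); have f1 := le_trans f0 nd.
have /andP[a1 a2] := truncn_itv D0.
have /andP[b1 b2] := truncn_itv f0.
have /andP[c1 c2] := truncn_itv f1.
move: a1 a2 b1 b2 c1 c2; set u := Num.truncn _; set v := Num.truncn _; set w := Num.truncn _.
rewrite -!natr1 => a1 a2 b1 b2 c1 c2.
have h1 : ((v + u)%:R : R) < w.+1%:R by rewrite natrD -natr1; lra.
have h2 : (w%:R : R) < (v + u).+2%:R by rewrite -!natr1 natrD; lra.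
move: h1 h2; rewrite !ltr_nat; clear; lia.
Qed.

End VanDerCorput.

(** * Return to complex weights and the original averages *)

Lemma power_bounded_nrm (R : realType) (H : normedModType R[i])
    (T : {linear H -> H}) : power_bounded T ->
  exists2 M, 1 <= M & forall n v, nrm (iter n T v) <= M * nrm v.
Proof.
rewrite /power_bounded => Tpb.
have [C hC] : exists C : R,
    (ereal_sup (range (fun n : nat => opnorm (iter n T))) <= C%:E)%E.
  by case: ereal_sup Tpb => [r _|//|_]; [exists r|exists 0; rewrite leNye].
exists (`|C| + 1) => [|n v]; first by rewrite lerDr.
have [->|v0] := eqVneq v 0; first by rewrite iter0v nrm0 mulr0.
have nv : 0 < nrm v.
  rewrite lt_neqAle nrm_ge0 andbT eq_sym.
  by apply/eqP => /nrm_eq0/eqP; rewrite (negPf v0).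
pose w := ((nrm v)^-1)%:C *: v.
have w1 : `|w| <= 1.
  by rewrite nrmE nrmZ_real gtr0_norm ?invr_gt0// mulVf ?gt_eqF.
have : ((nrm (iter n T w))%:E <= C%:E)%E.
  apply: le_trans hC; apply: le_trans (ereal_sup_ubound _); last by exists n.
  by apply: ereal_sup_ubound; exists w.
rewrite lee_fin iter_linZ nrmZ_real gtr0_norm ?invr_gt0// mulrC ler_pdivrMr//.
move/le_trans; apply; rewrite ler_pM2r//.
by have := ler_norm C; lra.
Qed.

Lemma weighted_average_cvg0 (R : realType) (H : completeNormedModType R[i])
    (T : {linear H -> H}) (M : R) (a : nat -> nat) (g : nat -> R)
    (x : H) (y : nat -> H) n0 :
  (forall n v, nrm (iter n T v) <= M * nrm v) -> good T a ->
  (forall n, nrm (y n) <= M * nrm x) ->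
  (forall n, (n0 <= n)%N -> y n = iter (a n) T x) ->
  (fun N : nat => (N%:R : R[i])^-1 *: \sum_(1 <= n < N.+1) e2pii (g n) *: y n)
    @ \oo --> (0 : H).
Proof.
move=> T_bound Ga yM ya; apply: cvg_nrm => e e0.
pose cn n := cos (2 * pi * g n); pose sn n := sin (2 * pi * g n).
(* The cosine and sine parts are two real weighted sums of N + 1 <= 2 N terms, contributing N e / 2
   together; the initial terms get the other half. *)
have e8 : 0 < e / 8 by rewrite divr_gt0.
have [n1 n1P] := Ga x _ e8.
set B := M * nrm x in yM.
have B0 : 0 <= B := le_trans (nrm_ge0 _) (yM 0%N).
have [n2 n2P] := natr_eventually (n0.+1%:R * (B + B) / (e / 2)).
exists (maxn 1 (maxn n1 n2)) => N; rewrite !geq_max subr0 => /and3P[N1 nN1 /n2P].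
rewrite ler_pdivrMr ?divr_gt0// => N2.
have NR : 0 < N%:R :> R by rewrite ltr0n.
have -> : (N%:R : R[i])^-1 = (N%:R^-1)%:C by rewrite fmorphV rmorph_nat.
rewrite nrmZ_real gtr0_norm ?invr_gt0// mulrC ler_pdivrMr//.
(* The averages start at n = 1 whereas [weighted_sum] starts at 0; the discrepancy at 0 goes into
   [D], along with the indices where [y n] is not yet [iter (a n) T x]. *)
pose F n := if n is 0 then 0 else e2pii (g n) *: y n.
pose D n := F n - e2pii (g n) *: iter (a n) T x.
have -> : \sum_(1 <= n < N.+1) e2pii (g n) *: y n = \sum_(n < N.+1) F n.
  rewrite -(big_mkord xpredT F) [RHS]big_ltn// add0r.
  by apply: eq_big_nat => -[].
have -> : \sum_(n < N.+1) F n = weighted_sum T a cn x N.+1 +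
    'i%C *: weighted_sum T a sn x N.+1 + \sum_(n < N.+1) D n.
  rewrite /weighted_sum scaler_sumr -!big_split/=; apply: eq_bigr => n _.
  rewrite /D addrC scalerA -scalerDl (_ : _ + _ * _ = e2pii (g n)) ?subrK//.
  by apply/eqP; rewrite eq_complex /= /cn /sn; apply/andP; split; apply/eqP; ring.
have hD : nrm (\sum_(n < N.+1) D n) <= n0.+1%:R * (B + B).
  apply: nrm_prefix => [|[|n]|[|n]//]; first by rewrite addr_ge0.
  - rewrite /D /= sub0r nrmN nrmZ cabs_e2pii mul1r.
    by rewrite (le_trans (T_bound _ _))// lerDl.
  - rewrite /D (le_trans (nrmBD _ _))//= !nrmZ cabs_e2pii !mul1r lerD//.
  - by move=> n0n; rewrite /D /= ya ?subrr// ltnW.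
have NS : (n1 <= N.+1)%N by rewrite leqW.
have h1 : nrm (weighted_sum T a cn x N.+1) <= N.+1%:R * (e / 8).
  by apply: n1P => // n; rewrite ler_norml cos_geN1 cos_le1.
have h2 : nrm (weighted_sum T a sn x N.+1) <= N.+1%:R * (e / 8).
  by apply: n1P => // n; rewrite ler_norml sin_geN1 sin_le1.
have i1 : cabs ('i%C : R[i]) = 1.
  by rewrite /cabs normc_def /= expr0n expr1n add0r sqrtr1.
have := nrmD (weighted_sum T a cn x N.+1) ('i%C *: weighted_sum T a sn x N.+1).
have := nrmD (weighted_sum T a cn x N.+1 + 'i%C *: weighted_sum T a sn x N.+1)
  (\sum_(n < N.+1) D n).
have : N.+1%:R * (e / 8) <= 2 * N%:R * (e / 8).
  rewrite ler_pM2r// -natr1; have : 1 <= N%:R :> R by rewrite ler1n.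
  by lra.
by rewrite nrmZ i1; lra.
Qed.

Theorem theorem4p14 (R : realType) (H : completeNormedModType R[i])
    (dot : {dot H for Num.conj})
    (dot_norm : forall x : H, dot x x = `|x| ^+ 2)
    (T : {linear H -> H}) (T_cont : continuous T)
    (T_pb : power_bounded T)
    (T_eig : point_spectrum T `&` unit_circle R = set0)
    (m : nat) (m_gt0 : (0 < m)%N) (t0 : R) (f : R -> R)
    (fP : class_P m t0 f)
    (k : nat) (c alpha : 'I_k.+1 -> R) (x : H) :
  (fun N : nat => (N%:R : R[i])^-1 *:
     \sum_(1 <= n < N.+1)
        e2pii (real_power_sum c alpha n%:R) *: iter_int_part T t0 f n x)
    @ \oo --> (0 : H).
Proof.
have [M M1 T_bound] := power_bounded_nrm T_pb.
have {}T_eig t v : T v = e2pii t *: v -> v = 0.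
  move=> Tv; apply/eqP; apply: contraT => v0.
  suff : (point_spectrum T `&` unit_circle R) (e2pii t) by rewrite T_eig.
  by split; [exists v|rewrite /unit_circle /= cabsE cabs_e2pii].
case: m m_gt0 fP => // m _ fP; have {}fP := class_P_discrete fP.
have Gid := good_id dot_norm T_bound M1 T_eig.
have Ga := good_discrete_P dot_norm T_bound M1 fP Gid.
(* Beyond both thresholds n >= t0 and f(n) > 0, so the exponent is the integer part; before them the
   default value [x] still has norm at most M times that of [x]. *)
case: fP => C [n0 fP]; have [n1 n1P] := natr_eventually t0.
apply: (@weighted_average_cvg0 R H T M _ (fun n => real_power_sum c alpha n%:R)
  x _ (maxn n0 n1) T_bound Ga) => n.
  rewrite /iter_int_part; case: ifP => _ //.
  by rewrite ler_peMl ?nrm_ge0.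
rewrite geq_max => /andP[/fP[f_pos _ _] /n1P t0n].
have {}f_pos : 0 <= f n%:R by exact/ltW/(f_pos 0%N).
by rewrite /iter_int_part t0n floor_ge0 f_pos truncn_floor f_pos.
Qed.
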